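(* The compact quantum groups $\mathbb{G}_\infty^{\mathrm{even}}$ and $\mathbb{G}_\infty^{\mathrm{odd}}$ are not isomorphic.
   Context: A compact quantum group $\mathbb{G}$ is determined by its Hopf $*$-algebra $\mathrm{Pol}(\mathbb{G})$; two compact quantum groups are isomorphic if their Hopf $*$-algebras $\mathrm{Pol}$ are isomorphic as Hopf $*$-algebras. A morphism from $\mathbb{G}_1$ to $\mathbb{G}_2$ is a unital $*$-homomorphism $\mathrm{C}(\mathbb{G}_2)\to\mathrm{C}(\mathbb{G}_1)$ intertwining comultiplications. If $\mathbb{G}_n$ are compact quantum groups with compatible morphisms given by maps $\mathrm{C}(\mathbb{G}_n)\to\mathrm{C}(\mathbb{G}_m)$, $n<m$, then $\varprojlim\mathbb{G}_n$ denotes the compact quantum group whose $\mathrm{C}^*$-algebra is the inductive limit of the $\mathrm{C}(\mathbb{G}_n)$, with the induced comultiplication; its $\mathrm{Pol}$ algebra is here the algebraic inductive limit. Doubling. For a Hopf $*$-algebra $(\mathcal{A},\Delta)$ with a Hopf $*$-algebra automorphism $\theta$, $\theta^2=\mathrm{id}$, the doubling is the $*$-algebra $\widetilde{\mathcal{A}}=\mathcal{A}\oplus\mathcal{A}$ with comultiplication determined, with $\xi(a)=(a,0)$ and $\eta(a)=(0,a)$, by $$\Delta_{\widetilde{\mathcal{A}}}\circ\xi=\bigl(\xi\otimes\xi+\eta\otimes(\eta\circ\theta)\bigr)\circ\Delta,\qquad \Delta_{\widetilde{\mathcal{A}}}\circ\eta=\bigl(\xi\otimes\eta+\eta\otimes(\xi\circ\theta)\bigr)\circ\Delta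 .$$ The quantum groups in question. Let $\mathsf{S}_n$ be the symmetric group with nearest-neighbour transpositions $s^{(n)}_1,\dots,s^{(n)}_{n-1}$, and let $\theta_n$ be the automorphism of $\mathsf{S}_n$ (and of the Hopf $*$-algebra $\mathbb{C}[\mathsf{S}_n]$, whose comultiplication is $\gamma\mapsto\gamma\otimes\gamma$ for $\gamma\in\mathsf{S}_n$) with $\theta_n(s^{(n)}_i)=s^{(n)}_{n-i}$. Let $\mathbb{G}_n$ be the compact quantum group with $\mathrm{C}(\mathbb{G}_n)=\mathrm{Pol}(\mathbb{G}_n)=\mathbb{C}[\mathsf{S}_n]\oplus\mathbb{C}[\mathsf{S}_n]$ the doubling of $\mathbb{C}[\mathsf{S}_n]$ with respect to $\theta_n$. The injective group homomorphism $\varphi_n\colon\mathsf{S}_n\to\mathsf{S}_{n+2}$, $s^{(n)}_i\mapsto s^{(n+2)}_{i+1}$, satisfies $\theta_{n+2}\circ\varphi_n=\varphi_n\circ\theta_n$, so its linear extension induces a Hopf $*$-algebra map $\psi_n=\varphi_n\oplus\varphi_n\colon\mathrm{C}(\mathbb{G}_n)\to\mathrm{C}(\mathbb{G}_{n+2})$. Put $$\mathbb{G}_\infty^{\mathrm{odd}}=\varprojlim\bigl(\mathbb{G}_1\leftarrow\mathbb{G}_3\leftarrow\mathbb{G}_5\leftarrow\cdots\bigr),\qquad \mathbb{G}_\infty^{\mathrm{even}}=\varprojlim\bigl(\mathbb{G}_2\leftarrow\mathbb{G}_4\leftarrow\mathbb{G}_6\leftarrow\cdots\bigr),$$ with respect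 to the maps $\psi_n$. Equivalently, let $\mathsf{S}_\infty$ be the group of finitely supported permutations of $\mathbb{Z}$. Then $\mathrm{Pol}(\mathbb{G}_\infty^{\mathrm{even}})$ (resp. $\mathrm{Pol}(\mathbb{G}_\infty^{\mathrm{odd}})$) is the doubling of the Hopf $*$-algebra $\mathbb{C}[\mathsf{S}_\infty]$ with respect to the automorphism induced by conjugation by the permutation $k\mapsto1-k$ of $\mathbb{Z}$ (reflection about $\tfrac12$) (resp. $k\mapsto-k$, reflection about $0$). *)

(* Defs.v *)
From HB Require Import structures.
From mathcomp Require Import all_boot all_order all_algebra all_fingroup.
From mathcomp Require Import generic_quotient boolp reals complex.

Set Implicit Arguments.
Unset Strict Implicit.
Unset Printing Implicit Defensive.

Import GRing.Theory Num.Theory.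
Local Open Scope ring_scope.
Local Open Scope quotient_scope.

(** * The tensor product of two vector spaces *)

Section Tensor.
Variable K : numClosedFieldType.

Definition balanced (V W : lmodType K) (U : zmodType) (b : V -> W -> U) :=
  [/\ forall v v' w, b (v + v') w = b v w + b v' w,
      forall v w w', b v (w + w') = b v w + b v w' &
      forall c v w, b (c *: v) w = b v (c *: w)].

Section Construction.
Variables V W : lmodType K.

Definition teval (U : zmodType) (b : V -> W -> U) (s : seq (V * W)) : U :=
  \sum_(p <- s) b p.1 p.2.

(* A sequence [:: (v1, w1); ...; (vk, wk)] stands for the formal sum of the
   pure tensors vi (x) wi; two formal sums denote the same tensor iff no
   balanced map into an abelian group separates them. The resulting quotient
   is the usual one: see the universal property tlift_tens / tensor_ext below. *)
Definition tequiv (s t : seq (V * W)) : bool :=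
  `[< forall (U : zmodType) (b : V -> W -> U), balanced b ->
        teval b s = teval b t >].

Fact tequiv_refl : reflexive tequiv.
Proof. by move=> s; apply/asboolP. Qed.
Fact tequiv_sym : symmetric tequiv.
Proof.
by move=> s t; apply/asboolP/asboolP => h U b /h ->.
Qed.
Fact tequiv_trans : transitive tequiv.
Proof.
move=> t s u /asboolP h /asboolP h'; apply/asboolP => U b hb.
by rewrite h // h'.
Qed.

Canonical tequiv_equiv := EquivRel tequiv tequiv_refl tequiv_sym tequiv_trans.

Definition tensor := {eq_quot tequiv}.
HB.instance Definition _ := Choice.on tensor.

Definition tlift (U : zmodType) (b : V -> W -> U) (t : tensor) : U :=
  teval b (repr t).

Definition tens (v : V) (w : W) : tensor := \pi_tensor [:: (v, w)].

Lemma tlift_pi (U : zmodType) (b : V -> W -> U) s :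
  balanced b -> tlift b (\pi_tensor s) = teval b s.
Proof.
move=> hb; rewrite /tlift; case: piP => t /eqmodP /asboolP h.
by rewrite h.
Qed.

Lemma tlift_tens (U : zmodType) (b : V -> W -> U) v w :
  balanced b -> tlift b (tens v w) = b v w.
Proof. by move=> hb; rewrite tlift_pi// /teval big_seq1. Qed.

Lemma tequivP s t :
  (forall (U : zmodType) (b : V -> W -> U), balanced b ->
     teval b s = teval b t) -> \pi_tensor s = \pi_tensor t.
Proof. by move=> h; apply/eqmodP/asboolP. Qed.

Lemma tensor_sep (t t' : tensor) :
  (forall (U : zmodType) (b : V -> W -> U), balanced b ->
     tlift b t = tlift b t') -> t = t'.
Proof. by rewrite -[t]reprK -[t']reprK => h; apply: tequivP => U b hb; rewrite -!tlift_pi// h. Qed.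

Lemma teval_cat (U : zmodType) (b : V -> W -> U) s t :
  teval b (s ++ t) = teval b s + teval b t.
Proof. by rewrite /teval big_cat. Qed.

Lemma balanced0l (U : zmodType) (b : V -> W -> U) w : balanced b -> b 0 w = 0.
Proof. by case=> h _ _; apply: (addrI (b 0 w)); rewrite -h !addr0. Qed.

Lemma balancedNl (U : zmodType) (b : V -> W -> U) v w :
  balanced b -> b (- v) w = - b v w.
Proof.
move=> hb; apply: (addrI (b v w)); case: (hb) => h _ _.
by rewrite -h !subrr balanced0l.
Qed.

Definition tensor0 : tensor := \pi_tensor [::].
Definition tensorD (t u : tensor) : tensor := \pi_tensor (repr t ++ repr u).
Definition tensorN (t : tensor) : tensor :=
  \pi_tensor [seq (- p.1, p.2) | p <- repr t].

Lemma tlift0_ (U : zmodType) (b : V -> W -> U) :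
  balanced b -> tlift b tensor0 = 0.
Proof. by move=> hb; rewrite tlift_pi// /teval big_nil. Qed.

Lemma tliftD_ (U : zmodType) (b : V -> W -> U) t u :
  balanced b -> tlift b (tensorD t u) = tlift b t + tlift b u.
Proof. by move=> hb; rewrite tlift_pi// teval_cat. Qed.

Lemma tliftN_ (U : zmodType) (b : V -> W -> U) t :
  balanced b -> tlift b (tensorN t) = - tlift b t.
Proof.
move=> hb; rewrite tlift_pi// /tlift /teval big_map -sumrN.
by apply: eq_bigr => p _; rewrite balancedNl.
Qed.

Fact tensorA : associative tensorD.
Proof.
by move=> t u v; apply: tensor_sep => U b hb; rewrite !tliftD_// addrA.
Qed.
Fact tensorC : commutative tensorD.
Proof.
by move=> t u; apply: tensor_sep => U b hb; rewrite !tliftD_// addrC.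
Qed.
Fact tensor0D : left_id tensor0 tensorD.
Proof.
by move=> t; apply: tensor_sep => U b hb; rewrite tliftD_// tlift0_// add0r.
Qed.
Fact tensorND : left_inverse tensor0 tensorN tensorD.
Proof.
move=> t; apply: tensor_sep => U b hb.
by rewrite tliftD_// tlift0_// tliftN_// addNr.
Qed.

HB.instance Definition _ :=
  GRing.isZmodule.Build tensor tensorA tensorC tensor0D tensorND.

Lemma tlift_zmod_morphism (U : zmodType) (b : V -> W -> U) :
  balanced b -> zmod_morphism (tlift b).
Proof. by move=> hb t u; rewrite tliftD_// tliftN_. Qed.

Lemma tliftD (U : zmodType) (b : V -> W -> U) t u : balanced b ->
  tlift b (t + u) = tlift b t + tlift b u.
Proof. exact: tliftD_. Qed.

Lemma tlift_sum (U : zmodType) (b : V -> W -> U) I (r : seq I) F : balanced b ->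
  tlift b (\sum_(i <- r) F i) = \sum_(i <- r) tlift b (F i).
Proof.
move=> hb; elim: r => [|i r IH]; first by rewrite !big_nil tlift0_.
by rewrite !big_cons tliftD// IH.
Qed.

Lemma tens_balanced : balanced tens.
Proof.
split=> [v v' w|v w w'|c v w]; apply: tensor_sep => U b hb;
  rewrite ?tliftD// ?tlift_tens//; by case: hb.
Qed.

Lemma tensDl v v' w : tens (v + v') w = tens v w + tens v' w.
Proof. by case: tens_balanced. Qed.
Lemma tensDr v w w' : tens v (w + w') = tens v w + tens v w'.
Proof. by case: tens_balanced. Qed.

Lemma tensor_sum (t : tensor) : t = \sum_(p <- repr t) tens p.1 p.2.
Proof.
apply: tensor_sep => U b hb; rewrite tlift_sum//.
by apply: eq_bigr => p _; rewrite tlift_tens.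
Qed.

Lemma tensor_ind (P : tensor -> Prop) :
  P 0 -> (forall v w, P (tens v w)) ->
  (forall t u, P t -> P u -> P (t + u)) -> forall t, P t.
Proof.
move=> P0 P1 PD t; rewrite [t]tensor_sum.
by elim/big_ind: _ => // p _; apply: P1.
Qed.

Definition tensorZ (c : K) (t : tensor) : tensor :=
  tlift (fun v w => tens (c *: v) w) t.

Lemma balancedZ (c : K) (U : zmodType) (b : V -> W -> U) :
  balanced b -> balanced (fun v w => b (c *: v) w).
Proof.
case=> h1 h2 h3; split=> [v v' w|v w w'|d v w].
- by rewrite scalerDr h1.
- by rewrite h2.
- by rewrite scalerA mulrC -scalerA h3.
Qed.

Lemma tensorZE c v w : tensorZ c (tens v w) = tens (c *: v) w.
Proof. by rewrite /tensorZ tlift_tens//; apply/balancedZ/tens_balanced. Qed.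

Lemma tensorZD c : {morph tensorZ c : t u / t + u}.
Proof. by move=> t u; apply/tliftD/balancedZ/tens_balanced. Qed.

Lemma tensorZ0 c : tensorZ c 0 = 0.
Proof. by apply: (addrI (tensorZ c 0)); rewrite -tensorZD !addr0. Qed.

Fact tensorZA c d t : tensorZ c (tensorZ d t) = tensorZ (c * d) t.
Proof.
elim/tensor_ind: t => [|v w|t u ht hu]; rewrite ?tensorZ0 ?tensorZD ?ht ?hu//.
by rewrite !tensorZE scalerA.
Qed.
Fact tensorZ1 : left_id 1 tensorZ.
Proof.
elim/tensor_ind=> [|v w|t u ht hu]; rewrite ?tensorZ0 ?tensorZD ?ht ?hu//.
by rewrite !tensorZE scale1r.
Qed.
Fact tensorZDr : right_distributive tensorZ +%R.
Proof. by move=> c t u; rewrite tensorZD. Qed.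
Fact tensorZDl t : {morph tensorZ^~ t : c d / c + d}.
Proof.
move=> c d /=; elim/tensor_ind: t => [|v w|t u ht hu].
- by rewrite !tensorZ0 addr0.
- by rewrite !tensorZE scalerDl tensDl.
- by rewrite !tensorZD ht hu addrACA.
Qed.

HB.instance Definition _ :=
  GRing.Zmodule_isLmodule.Build K tensor tensorZA tensorZ1 tensorZDr tensorZDl.

Lemma tensZl c v w : tens (c *: v) w = c *: tens v w.
Proof. by rewrite -tensorZE. Qed.
Lemma tensZr c v w : tens v (c *: w) = c *: tens v w.
Proof. by rewrite -tensZl; case: tens_balanced => _ _ ->. Qed.

Lemma tensor_ext (U : zmodType) (f g : tensor -> U) :
  {morph f : t u / t + u} -> {morph g : t u / t + u} ->
  (forall v w, f (tens v w) = g (tens v w)) -> f =1 g.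
Proof.
move=> fD gD h; elim/tensor_ind=> [|//|t u ht hu]; last by rewrite fD gD ht hu.
have f0 : f 0 = 0 by apply: (addrI (f 0)); rewrite -fD !addr0.
have g0 : g 0 = 0 by apply: (addrI (g 0)); rewrite -gD !addr0.
by rewrite f0 g0.
Qed.

Lemma tliftZ (U : lmodType K) (b : V -> W -> U) c t : balanced b ->
  (forall c v w, b (c *: v) w = c *: b v w) ->
  tlift b (c *: t) = c *: tlift b t.
Proof.
move=> hb hz; move: t; apply: tensor_ext => [t u|t u|v w].
- by rewrite scalerDr tliftD.
- by rewrite tliftD// scalerDr.
- by rewrite -tensZl !tlift_tens.
Qed.

End Construction.
End Tensor.

Arguments tlift {K V W U} b t.
Arguments tens {K V W} v w.
Notation "V ⊗ W" := (tensor V%type W%type) (at level 40, left associativity) : type_scope.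
Notation "v ⊗ w" := (tens v w) (at level 40, left associativity) : ring_scope.

Section TensorMaps.
Variable K : numClosedFieldType.

Definition bilin (V W U : lmodType K) (b : V -> W -> U) :=
  (forall w, linear (b^~ w)) /\ (forall v, linear (b v)).

Lemma linear_add (V W : lmodType K) (f : V -> W) :
  linear f -> {morph f : x y / x + y}.
Proof. by move=> hf x y; move: (hf 1 x y); rewrite !scale1r. Qed.

Lemma linear_0 (V W : lmodType K) (f : V -> W) : linear f -> f 0 = 0.
Proof. by move=> hf; apply: (addrI (f 0)); rewrite -(linear_add hf) !addr0. Qed.

Lemma linear_scale (V W : lmodType K) (f : V -> W) :
  linear f -> forall c x, f (c *: x) = c *: f x.
Proof. by move=> hf c x; move: (hf c x 0); rewrite (linear_0 hf) !addr0. Qed.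

Lemma linear_mk (V W : lmodType K) (f : V -> W) :
  {morph f : x y / x + y} -> (forall c x, f (c *: x) = c *: f x) -> linear f.
Proof. by move=> h h' c x y; rewrite h h'. Qed.

Lemma linear_id (V : lmodType K) : linear (@id V).
Proof. by []. Qed.

Lemma linear_comp (V W X : lmodType K) (g : W -> X) (f : V -> W) :
  linear g -> linear f -> linear (g \o f).
Proof. by move=> hg hf c x y /=; rewrite hf hg. Qed.

Lemma linear_addf (V W : lmodType K) (f g : V -> W) :
  linear f -> linear g -> linear (fun x => f x + g x).
Proof. by move=> hf hg c x y /=; rewrite hf hg scalerDr addrACA. Qed.

Lemma bilin_balanced (V W U : lmodType K) (b : V -> W -> U) :
  bilin b -> balanced b.
Proof.
case=> hl hr; split=> *.
- by rewrite (linear_add (hl _)).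
- by rewrite (linear_add (hr _)).
- by rewrite (linear_scale (hl _)) (linear_scale (hr _)).
Qed.

Lemma bilin_tlift (V W U : lmodType K) (b : V -> W -> U) :
  bilin b -> linear (tlift b).
Proof.
move=> hb; apply: linear_mk => [t u|c t].
  exact/tliftD/bilin_balanced.
apply: tliftZ; first exact: bilin_balanced.
by move=> d v w; case: hb => hl _; rewrite (linear_scale (hl _)).
Qed.

Lemma bilin_tens (V W : lmodType K) : bilin (@tens K V W).
Proof.
by split=> [w|v]; apply: linear_mk => [x y|c x] /=;
  rewrite ?(tensDl, tensDr, tensZl, tensZr).
Qed.

Lemma bilin_comp (V W V' W' U : lmodType K) (b : V' -> W' -> U)
    (f : V -> V') (g : W -> W') :
  bilin b -> linear f -> linear g -> bilin (fun v w => b (f v) (g w)).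
Proof.
case=> hl hr hf hg; split=> [w|v] c x y /=; first by rewrite hf hl.
by rewrite hg hr.
Qed.

Lemma bilin_compl (V W U X : lmodType K) (b : V -> W -> U) (h : U -> X) :
  bilin b -> linear h -> bilin (fun v w => h (b v w)).
Proof.
by case=> hl hr hh; split=> [w|v] c x y /=; rewrite (hl, hr) hh.
Qed.

Lemma tlift_bilin (V W U : lmodType K) (b : V -> W -> U) v w :
  bilin b -> tlift b (v ⊗ w) = b v w.
Proof. by move=> hb; apply/tlift_tens/bilin_balanced. Qed.

Lemma tensor_lext (V W : lmodType K) (U : lmodType K) (f g : V ⊗ W -> U) :
  linear f -> linear g ->
  (forall v w, f (v ⊗ w) = g (v ⊗ w)) -> f =1 g.
Proof. by move=> hf hg; apply: tensor_ext; apply: linear_add. Qed.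

(* The map f ⊗ g. It is used for linear f and g, and for antilinear ones. *)
Definition tmap (V W V' W' : lmodType K) (f : V -> V') (g : W -> W') :
  V ⊗ W -> V' ⊗ W' := tlift (fun v w => f v ⊗ g w).

Section Tmap.
Variables (V W V' W' : lmodType K) (f : V -> V') (g : W -> W').
Hypotheses (hf : linear f) (hg : linear g).

Lemma tmap_linear : linear (tmap f g).
Proof. by apply/bilin_tlift/bilin_comp => //; apply: bilin_tens. Qed.

Lemma tmapE v w : tmap f g (v ⊗ w) = f v ⊗ g w.
Proof. by apply/tlift_bilin/bilin_comp => //; apply: bilin_tens. Qed.

End Tmap.

(* (u ⊗ v) ⊗ w |-> u ⊗ (v ⊗ w) *)
Definition tassoc (U V W : lmodType K) : (U ⊗ V) ⊗ W -> U ⊗ (V ⊗ W) :=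
  tlift (fun t w => tlift (fun u v => u ⊗ (v ⊗ w)) t).

Section Tassoc.
Variables (U V W : lmodType K).

Lemma tassoc_bilin (w : W) : bilin (fun (u : U) (v : V) => u ⊗ (v ⊗ w)).
Proof.
apply: (bilin_comp (b := @tens _ _ _)) => //; first exact: bilin_tens.
by case: (bilin_tens V W) => h _; apply: h.
Qed.

Lemma tassoc_bilin2 :
  bilin (fun t (w : W) => tlift (fun (u : U) (v : V) => u ⊗ (v ⊗ w)) t).
Proof.
split=> [w|t]; first exact/bilin_tlift/tassoc_bilin.
apply: linear_mk => [w w'|c w].
  move: t; apply: tensor_ext => [t u|t u|u v].
  - by rewrite tliftD//; apply/bilin_balanced/tassoc_bilin.
  - by rewrite !tliftD 1?addrACA//; apply/bilin_balanced/tassoc_bilin.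
  - by rewrite !tlift_bilin ?tensDr//; apply: tassoc_bilin.
move: t; apply: tensor_ext => [t u|t u|u v].
- by rewrite tliftD//; apply/bilin_balanced/tassoc_bilin.
- by rewrite !tliftD 1?scalerDr//; apply/bilin_balanced/tassoc_bilin.
- by rewrite !tlift_bilin ?tensZr//; apply: tassoc_bilin.
Qed.

Lemma tassocE u v w : tassoc ((u ⊗ v) ⊗ w) = u ⊗ (v ⊗ w) :> U ⊗ (V ⊗ W).
Proof.
rewrite /tassoc tlift_bilin; last exact: tassoc_bilin2.
exact/tlift_bilin/tassoc_bilin.
Qed.

Lemma tassoc_linear : linear (@tassoc U V W).
Proof. exact/bilin_tlift/tassoc_bilin2. Qed.

End Tassoc.

Lemma tensor3_lext (U V W X : lmodType K) (f g : (U ⊗ V) ⊗ W -> X) :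
  linear f -> linear g ->
  (forall u v w, f ((u ⊗ v) ⊗ w) = g ((u ⊗ v) ⊗ w)) -> f =1 g.
Proof.
move=> hf hg h; apply: tensor_lext => // t w; move: t.
apply: (tensor_lext (f := fun t => f (t ⊗ w)) (g := fun t => g (t ⊗ w))).
- by case: (bilin_tens (U ⊗ V)%type W) => hl _; apply: (linear_comp hf (hl w)).
- by case: (bilin_tens (U ⊗ V)%type W) => hl _; apply: (linear_comp hg (hl w)).
- by move=> u v; apply: h.
Qed.

(* The product of the algebra A ⊗ B. *)
Definition tmul (A B : algType K) (s t : A ⊗ B) : A ⊗ B :=
  tlift (fun a b => tlift (fun a' b' => (a * a') ⊗ (b * b')) t) s.

Section Tmul.
Variables A B : algType K.

Lemma bilin_mul : bilin (fun x y : A => x * y).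
Proof.
split=> [y|x] c u v /=; first by rewrite mulrDl scalerAl.
by rewrite mulrDr scalerAr.
Qed.

Lemma linear_mull (a : A) : linear ( *%R a).
Proof. by case: bilin_mul. Qed.
Lemma linear_mulr (a : A) : linear ( *%R^~ a).
Proof. by case: bilin_mul. Qed.
End Tmul.

Section Tmul2.
Variables A B : algType K.

Lemma tmul_bilin1 (a : A) (b : B) : bilin (fun a' b' => (a * a') ⊗ (b * b')).
Proof.
apply: (bilin_comp (b := @tens _ _ _)); first exact: bilin_tens.
  exact: linear_mull.
exact: linear_mull.
Qed.

Lemma tmul_bilin2 (t : A ⊗ B) :
  bilin (fun a b => tlift (fun a' b' => (a * a') ⊗ (b * b')) t).
Proof.
split=> [b|a]; apply: linear_mk => [x y|c x]; move: t; apply: tensor_lext;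
  try exact/bilin_tlift/tmul_bilin1;
  try by apply: linear_addf; exact/bilin_tlift/tmul_bilin1.
- by move=> v w; rewrite !tlift_bilin ?mulrDl ?tensDl//; apply: tmul_bilin1.
- move=> d u v; rewrite (bilin_tlift (tmul_bilin1 _ _)) scalerDr !scalerA.
  by rewrite mulrC.
- by move=> v w; rewrite !tlift_bilin -?scalerAl ?tensZl//; apply: tmul_bilin1.
- by move=> v w; rewrite !tlift_bilin ?mulrDl ?tensDr//; apply: tmul_bilin1.
- move=> d u v; rewrite (bilin_tlift (tmul_bilin1 _ _)) scalerDr !scalerA.
  by rewrite mulrC.
- by move=> v w; rewrite !tlift_bilin -?scalerAl ?tensZr//; apply: tmul_bilin1.
Qed.

Lemma tmulE a b a' b' :
  tmul (a ⊗ b) (a' ⊗ b') = (a * a') ⊗ (b * b') :> A ⊗ B.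
Proof.
rewrite /tmul tlift_bilin; last exact: tmul_bilin2.
exact/tlift_bilin/tmul_bilin1.
Qed.

Lemma tmul_bilin : bilin (@tmul A B).
Proof.
split=> [t|s]; first exact/bilin_tlift/tmul_bilin2.
move=> c t t'; rewrite /tmul.
move: s; apply: tensor_lext.
- exact/bilin_tlift/tmul_bilin2.
- apply: linear_addf; last exact/bilin_tlift/tmul_bilin2.
  move=> d u v; rewrite (bilin_tlift (tmul_bilin2 _)) scalerDr !scalerA.
  by rewrite mulrC.
- move=> a b; rewrite !(tlift_bilin _ _ (tmul_bilin2 _)).
  by rewrite (bilin_tlift (tmul_bilin1 _ _)).
Qed.

Lemma tmul_ext (U : lmodType K) (f g : A ⊗ B -> A ⊗ B -> U) :
  bilin f -> bilin g ->
  (forall a b a' b', f (a ⊗ b) (a' ⊗ b') = g (a ⊗ b) (a' ⊗ b')) ->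
  forall s t, f s t = g s t.
Proof.
move=> [fl fr] [gl gr] h s t; move: s.
apply: (tensor_lext (f := f^~ t) (g := g^~ t)) => // a b; move: t.
by apply: tensor_lext.
Qed.

End Tmul2.

Lemma tmap_ext (V W V' W' : lmodType K) (f f' : V -> V') (g g' : W -> W') t :
  f =1 f' -> g =1 g' -> tmap f g t = tmap f' g' t.
Proof. by move=> /funext -> /funext ->. Qed.

Lemma tmap_comp (V W V' W' V2 W2 : lmodType K)
   (f : V' -> V2) (g : W' -> W2) (f' : V -> V') (g' : W -> W') t :
  linear f -> linear g -> linear f' -> linear g' ->
  tmap f g (tmap f' g' t) = tmap (f \o f') (g \o g') t.
Proof.
move=> hf hg hf' hg'; move: t.
apply: (tensor_lext (f := tmap f g \o tmap f' g')).
- by apply: linear_comp; apply: tmap_linear.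
- by apply: tmap_linear; apply: linear_comp.
- by move=> v w /=; rewrite !tmapE//; apply: linear_comp.
Qed.

Lemma tmap_id (V W : lmodType K) (t : V ⊗ W) : tmap id id t = t.
Proof.
by move: t; apply: tensor_lext => // [|v w]; [apply: tmap_linear|rewrite tmapE].
Qed.

Lemma tmul_tmap (A B A' B' : algType K) (f f' f2 : A -> A') (g g' g2 : B -> B') :
  linear f -> linear f' -> linear f2 -> linear g -> linear g' -> linear g2 ->
  (forall x y, f x * f' y = f2 (x * y)) ->
  (forall x y, g x * g' y = g2 (x * y)) ->
  forall s t, tmul (tmap f g s) (tmap f' g' t) = tmap f2 g2 (tmul s t).
Proof.
move=> hf hf' hf2 hg hg' hg2 h h'.
apply: (tmul_ext (f := fun s t => tmul (tmap f g s) (tmap f' g' t))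
                 (g := fun s t => tmap f2 g2 (tmul s t))).
- by apply: bilin_comp; [apply: tmul_bilin|apply: tmap_linear..].
- by apply: bilin_compl; [apply: tmul_bilin|apply: tmap_linear].
- by move=> a b a' b'; rewrite !(tmapE, tmulE)// h h'.
Qed.

Lemma tmul_tmap0 (A B A' B' : algType K) (f f' : A -> A') (g g' : B -> B') :
  linear f -> linear f' -> linear g -> linear g' ->
  (forall x y, f x * f' y = 0) \/ (forall x y, g x * g' y = 0) ->
  forall s t, tmul (tmap f g s) (tmap f' g' t) = 0.
Proof.
move=> hf hf' hg hg' h.
have h0 : bilin (fun _ _ : (A ⊗ B)%type => 0 : (A' ⊗ B')%type).
  by split=> ? c x y; rewrite scaler0 addr0.
apply: (tmul_ext (f := fun s t => tmul (tmap f g s) (tmap f' g' t))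
                 (g := fun s t => 0)) => //.
- by apply: bilin_comp; [apply: tmul_bilin|apply: tmap_linear..].
- move=> a b a' b'; rewrite !(tmapE, tmulE)//; case: h => ->.
    by case: (bilin_tens A' B') => hl _; apply: (linear_0 (hl _)).
  by case: (bilin_tens A' B') => _ hr; apply: (linear_0 (hr _)).
Qed.

End TensorMaps.

Section TensorMaps2.
Variable K : numClosedFieldType.

Lemma tlift_ext (V W : lmodType K) (U : zmodType) (b b' : V -> W -> U) t :
  (forall v w, b v w = b' v w) -> tlift b t = tlift b' t.
Proof. by move=> h; apply: eq_bigr => p _; apply: h. Qed.

Lemma tlift_tmap (V W V' W' U : lmodType K) (b : V' -> W' -> U)
    (f : V -> V') (g : W -> W') t : bilin b -> linear f -> linear g ->
  tlift b (tmap f g t) = tlift (fun v w => b (f v) (g w)) t.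
Proof.
move=> hb hf hg; have hb' := bilin_comp hb hf hg.
move: t; apply: (tensor_lext (f := tlift b \o tmap f g)).
- by apply: linear_comp; [apply: bilin_tlift|apply: tmap_linear].
- exact: bilin_tlift.
- by move=> v w /=; rewrite tmapE// !tlift_bilin.
Qed.

Lemma linear_tlift (V W U X : lmodType K) (b : V -> W -> U) (h : U -> X) t :
  bilin b -> linear h -> h (tlift b t) = tlift (fun v w => h (b v w)) t.
Proof.
move=> hb hh; have hb' := bilin_compl hb hh.
move: t; apply: (tensor_lext (f := h \o tlift b)).
- by apply: linear_comp => //; apply: bilin_tlift.
- exact: bilin_tlift.
- by move=> v w /=; rewrite !tlift_bilin.
Qed.

End TensorMaps2.

(** * Hopf *-algebras *)

(* tlift b (v1 ⊗ w1 + ... + vk ⊗ wk) = b v1 w1 + ... + b vk wk, so that for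
   instance tlift (fun a b => hcounit a *: b) (hcomul x) is
   (counit ⊗ id)(Delta(x)). *)

Record hopfStarAlgebra (C : numClosedFieldType) := HopfStarAlgebra {
  hopf_alg :> algType C;
  hstar : hopf_alg -> hopf_alg;
  hcomul : hopf_alg -> hopf_alg ⊗ hopf_alg;
  hcounit : hopf_alg -> C;
  hantipode : hopf_alg -> hopf_alg;
  hstarK : involutive hstar;
  hstar_antilinear : forall c x y,
    hstar (c *: x + y) = c^* *: hstar x + hstar y;
  hstarM : forall x y, hstar (x * y) = hstar y * hstar x;
  hcomul_linear : linear hcomul;
  hcomulM : forall x y, hcomul (x * y) = tmul (hcomul x) (hcomul y);
  hcomul1 : hcomul 1 = 1 ⊗ 1;
  hcomul_star : forall x, hcomul (hstar x) = tmap hstar hstar (hcomul x);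
  hcomulA : forall x,
    tassoc (tmap hcomul id (hcomul x)) = tmap id hcomul (hcomul x);
  hcounit_scalar : scalar hcounit;
  hcounitM : {morph hcounit : x y / x * y};
  hcounit1 : hcounit 1 = 1;
  hcounitl : forall x, tlift (fun a b => hcounit a *: b) (hcomul x) = x;
  hcounitr : forall x, tlift (fun a b => hcounit b *: a) (hcomul x) = x;
  hantipode_linear : linear hantipode;
  hantipodel : forall x,
    tlift (fun a b => hantipode a * b) (hcomul x) = hcounit x *: 1;
  hantipoder : forall x,
    tlift (fun a b => a * hantipode b) (hcomul x) = hcounit x *: 1
}.

Section HopfTheory.
Variable C : numClosedFieldType.

(* Unital *-homomorphisms intertwining the comultiplications; they
   automatically preserve counits and antipodes (hom_counit, hom_antipode). *)
Record hopfStarHom (A B : hopfStarAlgebra C) := HopfStarHom {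
  hom_fun :> A -> B;
  hom_linear : linear hom_fun;
  homM : forall x y, hom_fun (x * y) = hom_fun x * hom_fun y;
  hom1 : hom_fun 1 = 1;
  hom_star : forall x, hom_fun (hstar x) = hstar (hom_fun x);
  hom_comul : forall x, hcomul (hom_fun x) = tmap hom_fun hom_fun (hcomul x)
}.

(* Compact quantum groups are isomorphic iff their algebras Pol are isomorphic
   in this sense. *)
Definition hopf_isomorphic (A B : hopfStarAlgebra C) :=
  exists f : hopfStarHom A B, bijective f.

Lemma bilin_scale (V : lmodType C) : bilin (fun (x : C^o) (y : V) => x *: y).
Proof.
split=> [w|v] c x y /=; first by rewrite scalerDl scalerA.
by rewrite scalerDr !scalerA mulrC.
Qed.

Section Convolution.
Variables (A : hopfStarAlgebra C) (B : algType C).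

Let counit_linear : linear (hcounit (h := A) : A -> C^o).
Proof. exact: hcounit_scalar. Qed.

Definition conv (f g : A -> B) (x : A) : B :=
  tlift (fun a b => f a * g b) (hcomul x).

Lemma bilin_conv f g : linear f -> linear g -> bilin (fun a b : A => f a * g b : B).
Proof. by apply: bilin_comp; apply: bilin_mul. Qed.

Lemma conv_linear f g : linear f -> linear g -> linear (conv f g).
Proof.
move=> hf hg; apply: (linear_comp (g := tlift _)) (hcomul_linear (h := A)).
exact/bilin_tlift/bilin_conv.
Qed.

Lemma convA f g h : linear f -> linear g -> linear h ->
  conv (conv f g) h =1 conv f (conv g h).
Proof.
move=> hf hg hh x; rewrite {1}/conv /conv.
pose fg := tlift (fun a b : A => f a * g b).
pose gh := tlift (fun a b : A => g a * h b).
have hfg : linear fg by exact/bilin_tlift/bilin_conv.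
have hgh : linear gh by exact/bilin_tlift/bilin_conv.
have b1 : bilin (fun t a => fg t * h a) by apply: bilin_comp => //; apply: bilin_mul.
have b2 : bilin (fun a t => f a * gh t) by apply: bilin_comp => //; apply: bilin_mul.
have -> : tlift (fun a b => fg (hcomul a) * h b) (hcomul x) =
          tlift (fun t a => fg t * h a) (tmap (hcomul (h:=A)) id (hcomul x)).
  by rewrite tlift_tmap//; apply: hcomul_linear.
have -> : tlift (fun a b => f a * gh (hcomul b)) (hcomul x) =
          tlift (fun a t => f a * gh t) (tmap id (hcomul (h:=A)) (hcomul x)).
  by rewrite tlift_tmap//; apply: hcomul_linear.
rewrite -hcomulA; move: (tmap _ _ _).
apply: (tensor3_lext (g := tlift (fun a t => f a * gh t) \o (@tassoc _ _ _ _))).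
- exact: bilin_tlift.
- by apply: linear_comp; [apply: bilin_tlift|apply: tassoc_linear].
- move=> u v w /=; rewrite tassocE !tlift_bilin//.
  by rewrite /fg /gh !tlift_bilin ?mulrA//; apply: bilin_conv.
Qed.

Lemma conv1r f : linear f -> conv f (fun x => hcounit x *: 1) =1 f.
Proof.
move=> hf x; rewrite -[RHS](congr1 f (hcounitr x)) linear_tlift//.
  by apply: tlift_ext => a b; rewrite -scalerAr mulr1 (linear_scale hf).
split=> [w|v] c y z /=; first by rewrite scalerDr !scalerA mulrC.
by rewrite (hcounit_scalar c) scalerDl scalerA.
Qed.

Lemma conv1l f : linear f -> conv (fun x => hcounit x *: 1) f =1 f.
Proof.
move=> hf x; rewrite -[RHS](congr1 f (hcounitl x)) linear_tlift//.
  by apply: tlift_ext => a b; rewrite -scalerAl mul1r (linear_scale hf).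
split=> [w|v] c y z /=; last by rewrite scalerDr !scalerA mulrC.
by rewrite (hcounit_scalar c) scalerDl scalerA.
Qed.

Lemma conv_inv_uniq f g h : linear f -> linear g -> linear h ->
  conv f g =1 (fun x => hcounit x *: 1) ->
  conv g h =1 (fun x => hcounit x *: 1) -> f =1 h.
Proof.
move=> hf hg hh fg gh x.
by rewrite -[RHS](conv1l hh) -(funext fg) convA// (funext gh) conv1r.
Qed.

End Convolution.

Lemma hom_counit (A B : hopfStarAlgebra C) (f : hopfStarHom A B) x :
  hcounit (f x) = hcounit x.
Proof.
pose chi (x : A) : C^o := hcounit (f x).
have hB : linear (hcounit (h := B) : B -> C^o) by exact: hcounit_scalar.
have hchi : linear chi by apply: (linear_comp hB (hom_linear f)).
have chiM : conv chi chi =1 chi.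
  move=> a; rewrite [RHS]/chi.
  have := congr1 (hcounit (h := B) : B -> C^o) (hcounitl (f a)).
  rewrite hom_comul tlift_tmap; try exact: hom_linear; last first.
    by apply: (bilin_comp (@bilin_scale B) hB (@linear_id _ _)).
  rewrite (linear_tlift _ _ hB) => [<-|].
    by apply: tlift_ext => u v; rewrite (linear_scale hB).
  by apply: (bilin_comp (@bilin_scale B) _ (hom_linear f)); apply: (linear_comp hB (hom_linear f)).
pose chiS := chi \o (hantipode (h := A)).
have hS : linear chiS by apply: (linear_comp hchi (hantipode_linear (h:=A))).
have chiV : conv chi chiS =1 (fun x => hcounit x *: (1 : C^o)).
  move=> a; have := congr1 chi (hantipoder a).
  rewrite (linear_tlift _ _ hchi); last first.
    by apply: bilin_conv => //; apply: hantipode_linear.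
  rewrite (linear_scale hchi) [in X in _ = X -> _]/chi hom1 hcounit1 => <-.
  by apply: tlift_ext => u v; rewrite /chiS /= /chi homM hcounitM.
have e1 : linear (fun x : A => hcounit x *: (1 : C^o)).
  by move=> c u v; rewrite hcounit_scalar scalerDl scalerA.
have := conv1r hchi x; have -> : hcounit (f x) = chi x by [].
rewrite -(funext chiV) -convA// (funext chiM) chiV => <-.
by rewrite /GRing.scale /= mulr1.
Qed.

Lemma hom_antipode (A B : hopfStarAlgebra C) (f : hopfStarHom A B) x :
  f (hantipode x) = hantipode (f x).
Proof.
have SA := hantipode_linear (h := A); have SB := hantipode_linear (h := B).
have hf := hom_linear f.
apply: (@conv_inv_uniq A B (f \o @hantipode _ _) f (@hantipode _ _ \o f)) => //.
- exact: linear_comp.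
- exact: linear_comp.
- move=> a; have := congr1 f (hantipodel a).
  rewrite (linear_tlift _ _ hf); last exact: bilin_conv.
  rewrite (linear_scale hf) hom1 => <-.
  by apply: tlift_ext => u v; rewrite /= homM.
- move=> a; have := hantipoder (f a).
  rewrite hom_comul tlift_tmap//; last exact: bilin_conv.
  by rewrite hom_counit.
Qed.

End HopfTheory.

Section Antilinear.
Variable C : numClosedFieldType.

Definition antilinear (V W : lmodType C) (s : V -> W) :=
  forall c x y, s (c *: x + y) = c^* *: s x + s y.

Section AntiTheory.
Variables (V W V' W' : lmodType C) (s : V -> V') (s' : W -> W').
Hypotheses (hs : antilinear s) (hs' : antilinear s').

Lemma antilinearD (X Y : lmodType C) (r : X -> Y) :
  antilinear r -> {morph r : x y / x + y}.
Proof. by move=> h x y; move: (h 1 x y); rewrite conjC1 !scale1r. Qed.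

Lemma antilinear0 (X Y : lmodType C) (r : X -> Y) : antilinear r -> r 0 = 0.
Proof. by move=> h; apply: (addrI (r 0)); rewrite -(antilinearD h) !addr0. Qed.

Lemma antilinearZ (X Y : lmodType C) (r : X -> Y) c x :
  antilinear r -> r (c *: x) = c^* *: r x.
Proof. by move=> h; move: (h c x 0); rewrite (antilinear0 h) !addr0. Qed.

Lemma anti_balanced : balanced (fun v w => s v ⊗ s' w).
Proof.
split=> *.
- by rewrite (antilinearD hs) tensDl.
- by rewrite (antilinearD hs') tensDr.
- by rewrite (antilinearZ _ _ hs) (antilinearZ _ _ hs') tensZl tensZr.
Qed.

Lemma tmap_antiE v w : tmap s s' (v ⊗ w) = s v ⊗ s' w.
Proof. exact/tlift_tens/anti_balanced. Qed.

Lemma tmap_antiD : {morph tmap s s' : t u / t + u}.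
Proof. by move=> t u; apply/tliftD/anti_balanced. Qed.

End AntiTheory.

Lemma tmap_anti_comm (V W V' W' V2 W2 V3 W3 : lmodType C)
    (s : V' -> V3) (s' : W' -> W3) (f : V -> V') (g : W -> W')
    (r : V -> V2) (r' : W -> W2) (f2 : V2 -> V3) (g2 : W2 -> W3) t :
  antilinear s -> antilinear s' -> antilinear r -> antilinear r' ->
  linear f -> linear g -> linear f2 -> linear g2 ->
  (forall v, s (f v) = f2 (r v)) -> (forall w, s' (g w) = g2 (r' w)) ->
  tmap s s' (tmap f g t) = tmap f2 g2 (tmap r r' t).
Proof.
move=> hs hs' hr hr' hf hg hf2 hg2 h h'; move: t.
apply: (tensor_ext (f := tmap s s' \o tmap f g)
                   (g := tmap f2 g2 \o tmap r r')) => /=.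
- by move=> t u /=; rewrite (linear_add (tmap_linear hf hg)) tmap_antiD.
- by move=> t u /=; rewrite tmap_antiD// (linear_add (tmap_linear hf2 hg2)).
- by move=> v w; rewrite /= (tmapE hf hg) (tmap_antiE hs hs') (tmap_antiE hr hr') (tmapE hf2 hg2) h h'.
Qed.
End Antilinear.

(** * The doubling of a Hopf *-algebra along an involutive automorphism *)

Section Doubling.
Variable C : numClosedFieldType.

Definition doubleAlg (A : algType C) : algType C :=
  Eval cbv [reverse_coercion] in (A * A)%type.

Section Embeddings.
Variable A : algType C.
Definition dxi (a : A) : doubleAlg A := (a, 0).
Definition deta (a : A) : doubleAlg A := (0, a).

Lemma dxi_linear : linear dxi.
Proof. by move=> c x y; congr pair; rewrite /= scaler0 addr0. Qed.
Lemma deta_linear : linear deta.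
Proof. by move=> c x y; congr pair; rewrite /= scaler0 addr0. Qed.
Lemma dxiM a b : dxi a * dxi b = dxi (a * b).
Proof. by congr pair; rewrite /= mulr0. Qed.
Lemma detaM a b : deta a * deta b = deta (a * b).
Proof. by congr pair; rewrite /= mulr0. Qed.
Lemma dxi_eta a b : dxi a * deta b = 0.
Proof. by congr pair; rewrite /= (mulr0, mul0r). Qed.
Lemma deta_xi a b : deta a * dxi b = 0.
Proof. by congr pair; rewrite /= (mulr0, mul0r). Qed.
Lemma dpairE (p : doubleAlg A) : p = dxi p.1 + deta p.2.
Proof. by case: p => a b; congr pair; rewrite /= (addr0, add0r). Qed.
Lemma double1 : (1 : doubleAlg A) = dxi 1 + deta 1.
Proof. exact: dpairE. Qed.
End Embeddings.

Lemma double_lext (A : algType C) (V : lmodType C) (f g : doubleAlg A -> V) :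
  linear f -> linear g -> (forall a, f (dxi a) = g (dxi a)) ->
  (forall a, f (deta a) = g (deta a)) -> f =1 g.
Proof.
move=> hf hg h1 h2 p.
by rewrite [p]dpairE (linear_add hf) (linear_add hg) h1 h2.
Qed.

Section DoublingAlgebra.
Variables (A : hopfStarAlgebra C) (theta : hopfStarHom A A).
Hypothesis thetaK : involutive theta.

Local Notation D := (doubleAlg A).
Local Notation xi := (@dxi A).
Local Notation eta := (@deta A).
Let hxi : linear xi. Proof. exact: dxi_linear. Qed.
Let heta : linear eta. Proof. exact: deta_linear. Qed.
Let hth : linear theta. Proof. exact: hom_linear. Qed.
Let hxith : linear (xi \o theta). Proof. exact: linear_comp. Qed.
Let hetath : linear (eta \o theta). Proof. exact: linear_comp. Qed.
Let hcom : linear (hcomul (h := A)). Proof. exact: hcomul_linear. Qed.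
Let hS : linear (hantipode (h := A)). Proof. exact: hantipode_linear. Qed.
Let hc : linear (hcounit (h := A) : A -> C^o). Proof. exact: hcounit_scalar. Qed.

Definition dstar (p : D) : D := (hstar p.1, hstar p.2).

(* (xi ⊗ xi + eta ⊗ (eta \o theta)) \o Delta on the first summand,
   (xi ⊗ eta + eta ⊗ (xi \o theta)) \o Delta on the second one. *)
Definition dcomul (p : D) : D ⊗ D :=
  (tmap xi xi (hcomul p.1) + tmap eta (eta \o theta) (hcomul p.1)) +
  (tmap xi eta (hcomul p.2) + tmap eta (xi \o theta) (hcomul p.2)).

Definition dcounit (p : D) : C := hcounit p.1.
Definition dantipode (p : D) : D := (hantipode p.1, theta (hantipode p.2)).

Lemma dcomul_xi a :
  dcomul (xi a) = tmap xi xi (hcomul a) + tmap eta (eta \o theta) (hcomul a).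
Proof.
rewrite /dcomul /= (linear_0 hcom).
rewrite (linear_0 (tmap_linear hxi heta)) (linear_0 (tmap_linear heta hxith)).
by rewrite !addr0.
Qed.

Lemma dcomul_eta a :
  dcomul (eta a) = tmap xi eta (hcomul a) + tmap eta (xi \o theta) (hcomul a).
Proof.
rewrite /dcomul /= (linear_0 hcom).
rewrite (linear_0 (tmap_linear hxi hxi)) (linear_0 (tmap_linear heta hetath)).
by rewrite !add0r.
Qed.

Fact dcomul_linear : linear dcomul.
Proof.
have h1 : linear (fun p : D => hcomul p.1).
  by move=> c x y; rewrite /= hcomul_linear.
have h2 : linear (fun p : D => hcomul p.2).
  by move=> c x y; rewrite /= hcomul_linear.
apply: linear_addf; apply: linear_addf.
- exact: (linear_comp (tmap_linear hxi hxi) h1).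
- exact: (linear_comp (tmap_linear heta hetath) h1).
- exact: (linear_comp (tmap_linear hxi heta) h2).
- exact: (linear_comp (tmap_linear heta hxith) h2).
Qed.

Fact dstarK : involutive dstar.
Proof. by case=> a b; rewrite /dstar /= !hstarK. Qed.
Fact dstar_antilinear c x y : dstar (c *: x + y) = c^* *: dstar x + dstar y.
Proof. by congr pair; rewrite /= hstar_antilinear. Qed.
Fact dstarM x y : dstar (x * y) = dstar y * dstar x.
Proof. by congr pair; rewrite /= hstarM. Qed.

Fact dcomulM x y : dcomul (x * y) = tmul (dcomul x) (dcomul y).
Proof.
have [tl tr] := tmul_bilin D D.
have hl z : linear (fun x => dcomul (x * z)).
  by apply: (linear_comp dcomul_linear (linear_mulr z)).
have hr z : linear (fun x => dcomul (z * x)).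
  by apply: (linear_comp dcomul_linear (linear_mull z)).
move: x; apply: double_lext => //.
- exact: (linear_comp (tl _) dcomul_linear).
- move=> a; move: y; apply: double_lext => //.
  + exact: (linear_comp (tr _) dcomul_linear).
  + move=> b; rewrite dxiM !dcomul_xi.
    rewrite (linear_add (tr _)) !(linear_add (tl _)).
    rewrite (@tmul_tmap _ _ _ _ _ xi xi xi xi xi xi)//; try exact: dxiM.
    rewrite (@tmul_tmap _ _ _ _ _ eta eta eta (eta \o theta) (eta \o theta)
      (eta \o theta))//; try exact: detaM; last first.
      by move=> u v; rewrite /= homM; apply: detaM.
    rewrite !tmul_tmap0 ?addr0 ?add0r//; try by left; apply: dxi_eta.
      by rewrite hcomulM.
    by left; apply: deta_xi.
  + move=> b; rewrite dxi_eta (linear_0 dcomul_linear) dcomul_xi dcomul_eta.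
    rewrite (linear_add (tr _)) !(linear_add (tl _)).
    rewrite !tmul_tmap0 ?addr0 ?add0r//.
    * by right=> u v; apply: deta_xi.
    * by left=> u v; apply: dxi_eta.
    * by left=> u v; apply: deta_xi.
    * by right=> u v; apply: dxi_eta.
- move=> a; move: y; apply: double_lext => //.
  + exact: (linear_comp (tr _) dcomul_linear).
  + move=> b; rewrite deta_xi (linear_0 dcomul_linear) dcomul_xi dcomul_eta.
    rewrite (linear_add (tr _)) !(linear_add (tl _)).
    rewrite !tmul_tmap0 ?addr0 ?add0r//.
    * by right=> u v; apply: dxi_eta.
    * by left=> u v; apply: dxi_eta.
    * by left=> u v; apply: deta_xi.
    * by right=> u v; apply: deta_xi.
  + move=> b; rewrite detaM !dcomul_eta.
    rewrite (linear_add (tr _)) !(linear_add (tl _)).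
    rewrite (@tmul_tmap _ _ _ _ _ xi xi xi eta eta eta)//; try exact: dxiM;
      try exact: detaM.
    rewrite (@tmul_tmap _ _ _ _ _ eta eta eta (xi \o theta) (xi \o theta)
      (xi \o theta))//; try exact: detaM; last first.
      by move=> u v; rewrite /= homM; apply: dxiM.
    rewrite !tmul_tmap0 ?addr0 ?add0r//; try by left; apply: dxi_eta.
      by rewrite hcomulM.
    by left; apply: deta_xi.
Qed.

Fact dcomul1 : dcomul 1 = 1 ⊗ 1.
Proof.
rewrite double1 (linear_add dcomul_linear) dcomul_xi dcomul_eta hcomul1.
rewrite !tmapE//= hom1 !tensDl !tensDr.
by rewrite addrACA [X in _ + X = _]addrC [in RHS]addrACA addrACA.
Qed.


Fact dcomul_star x : dcomul (dstar x) = tmap dstar dstar (dcomul x).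
Proof.
have hs : antilinear (hstar (h := A)) by exact: hstar_antilinear.
have hd : antilinear dstar by exact: dstar_antilinear.
have sxi a : dstar (xi a) = xi (hstar a).
  by congr pair; rewrite /= (antilinear0 hs).
have seta a : dstar (eta a) = eta (hstar a).
  by congr pair; rewrite /= (antilinear0 hs).
have sth a : theta (hstar a) = hstar (theta a) by exact: hom_star.
have dD : {morph dcomul : x y / x + y} by apply: linear_add dcomul_linear.
have tD := tmap_antiD hd hd.
rewrite [x]dpairE (antilinearD hd) !dD tD.
rewrite sxi seta !dcomul_xi !dcomul_eta !hcomul_star !(tmap_antiD hd hd).
congr (_ + _ + (_ + _)); symmetry;
  by apply: (tmap_anti_comm _ hd hd hs hs) => // v /=; rewrite ?sxi ?seta ?sth.
Qed.

Let X (t : A ⊗ A) : D ⊗ D := tmap xi xi t + tmap eta (eta \o theta) t.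
Let Y (t : A ⊗ A) : D ⊗ D := tmap xi eta t + tmap eta (xi \o theta) t.
Let hX : linear X.
Proof. by apply: linear_addf; apply: tmap_linear. Qed.
Let hY : linear Y.
Proof. by apply: linear_addf; apply: tmap_linear. Qed.
Let htt : linear (tmap theta theta).
Proof. exact: tmap_linear. Qed.

Let cxi : dcomul \o xi =1 X \o (hcomul (h := A)).
Proof. by move=> a; rewrite /= dcomul_xi. Qed.
Let ceta : dcomul \o eta =1 Y \o (hcomul (h := A)).
Proof. by move=> a; rewrite /= dcomul_eta. Qed.
Let cxith : dcomul \o (xi \o theta) =1 (X \o tmap theta theta) \o (hcomul (h := A)).
Proof. by move=> a; rewrite /= dcomul_xi hom_comul. Qed.
Let cetath : dcomul \o (eta \o theta) =1 (Y \o tmap theta theta) \o (hcomul (h := A)).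
Proof. by move=> a; rewrite /= dcomul_eta hom_comul. Qed.

Let split1 (V W : lmodType C) (F : A ⊗ A -> V) (f : A -> W) a :
  linear F -> linear f ->
  tmap (F \o hcomul (h := A)) f (hcomul a) =
  tmap F f (tmap (hcomul (h := A)) id (hcomul a)).
Proof. by move=> hF hf; rewrite tmap_comp. Qed.

Let split2 (V W : lmodType C) (F : A ⊗ A -> V) (f : A -> W) a :
  linear F -> linear f ->
  tmap f (F \o hcomul (h := A)) (hcomul a) =
  tmap f F (tassoc (tmap (hcomul (h := A)) id (hcomul a))).
Proof. by move=> hF hf; rewrite hcomulA tmap_comp. Qed.

Fact dcomulA x : tassoc (tmap dcomul id (dcomul x)) = tmap id dcomul (dcomul x).
Proof.
have hd := dcomul_linear.
have hid := @linear_id _ D.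
have l1 : linear (tmap dcomul (@id D) : D ⊗ D -> (D ⊗ D) ⊗ D) by apply: tmap_linear.
have l2 : linear (tmap (@id D) dcomul : D ⊗ D -> D ⊗ (D ⊗ D)) by apply: tmap_linear.
have la := @tassoc_linear _ D D D.
have laA := @tassoc_linear _ A A A.
have hXt := linear_comp hX htt.
have hYt := linear_comp hY htt.
move: x; apply: (double_lext (f := @tassoc _ D D D \o (tmap dcomul id \o dcomul))
                             (g := tmap id dcomul \o dcomul)).
- exact/linear_comp/linear_comp.
- exact/linear_comp.
- move=> a /=; rewrite dcomul_xi (linear_add l1) (linear_add l2) !tmap_comp//.
  rewrite (tmap_ext _ cxi (frefl _)) (tmap_ext _ ceta (frefl _)).
  rewrite (tmap_ext _ (frefl _) cxi) (tmap_ext _ (frefl _) cetath).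
  rewrite !split1// !split2//; move: (tmap (@hcomul _ A) (@id A) (hcomul a)).
  apply: (tensor3_lext
    (f := fun u => tassoc (tmap X xi u + tmap Y (eta \o theta) u))
    (g := fun u => tmap xi X (tassoc u) + tmap eta (Y \o tmap theta theta) (tassoc u))).
  + by apply: (linear_comp la); apply: linear_addf; apply: tmap_linear.
  + apply: linear_addf; [apply: (linear_comp _ laA)..]; by apply: tmap_linear.
  + move=> u v w; rewrite tassocE !tmapE//= tmapE// /X /Y !tmapE//=.
    rewrite !tensDl !(linear_add la) !tassocE !tensDr thetaK.
    by rewrite -!addrA; congr (_ + _); rewrite addrC -!addrA addrC -!addrA.
- move=> a /=; rewrite dcomul_eta (linear_add l1) (linear_add l2) !tmap_comp//.
  rewrite (tmap_ext _ cxi (frefl _)) (tmap_ext _ ceta (frefl _)).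
  rewrite (tmap_ext _ (frefl _) ceta) (tmap_ext _ (frefl _) cxith).
  rewrite !split1// !split2//; move: (tmap (@hcomul _ A) (@id A) (hcomul a)).
  apply: (tensor3_lext
    (f := fun u => tassoc (tmap X eta u + tmap Y (xi \o theta) u))
    (g := fun u => tmap xi Y (tassoc u) + tmap eta (X \o tmap theta theta) (tassoc u))).
  + by apply: (linear_comp la); apply: linear_addf; apply: tmap_linear.
  + apply: linear_addf; [apply: (linear_comp _ laA)..]; by apply: tmap_linear.
  + move=> u v w; rewrite tassocE !tmapE//= tmapE// /X /Y !tmapE//=.
    rewrite !tensDl !(linear_add la) !tassocE !tensDr thetaK.
    by rewrite -!addrA; congr (_ + _); rewrite addrC -!addrA; congr (_ + _); rewrite addrC.
Qed.

Fact dcounit_scalar : scalar dcounit.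
Proof. by move=> c x y; rewrite /dcounit /= hcounit_scalar. Qed.
Fact dcounitM : {morph dcounit : x y / x * y}.
Proof. by move=> x y; rewrite /dcounit /= hcounitM. Qed.
Fact dcounit1 : dcounit 1 = 1.
Proof. exact: hcounit1. Qed.

Let hdc : linear (dcounit : D -> C^o). Proof. exact: dcounit_scalar. Qed.

Fact dcounitl x : tlift (fun a b => dcounit a *: b) (dcomul x) = x.
Proof.
have hb : bilin (fun a b : D => dcounit a *: b).
  exact: (bilin_comp (@bilin_scale C D) hdc (@linear_id _ _)).
have hbA : bilin (fun a b : A => hcounit a *: b).
  exact: (bilin_comp (@bilin_scale C A) hc (@linear_id _ _)).
have hl := bilin_tlift hb.
move: x; apply: (double_lext (f := tlift _ \o dcomul) (g := id)) => //.
- exact: (linear_comp hl dcomul_linear).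
- move=> a /=; rewrite dcomul_xi (linear_add hl) !tlift_tmap//.
  rewrite -[in RHS](hcounitl a) (linear_tlift _ _ hxi)//.
  rewrite [X in _ + X](_ : _ = 0) ?addr0.
    by apply: tlift_ext => u v; rewrite (linear_scale hxi).
  rewrite [LHS]big1// => p _.
  by rewrite /dcounit /= (linear_0 hc) scale0r.
- move=> a /=; rewrite dcomul_eta (linear_add hl) !tlift_tmap//.
  rewrite -[in RHS](hcounitl a) (linear_tlift _ _ heta)//.
  rewrite [X in _ + X](_ : _ = 0) ?addr0.
    by apply: tlift_ext => u v; rewrite (linear_scale heta).
  rewrite [LHS]big1// => p _.
  by rewrite /dcounit /= (linear_0 hc) scale0r.
Qed.

Fact dcounitr x : tlift (fun a b => dcounit b *: a) (dcomul x) = x.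
Proof.
have hbW (V : lmodType C) (e : V -> C) : scalar e -> bilin (fun a b : V => e b *: a).
  move=> he; split=> [w|v] c y z /=; first by rewrite scalerDr !scalerA mulrC.
  by rewrite he scalerDl scalerA.
have hb := hbW D _ dcounit_scalar.
have hbA := hbW A _ (hcounit_scalar (h := A)).
have hl := bilin_tlift hb.
move: x; apply: (double_lext (f := tlift _ \o dcomul) (g := id)) => //.
- exact: (linear_comp hl dcomul_linear).
- move=> a /=; rewrite dcomul_xi (linear_add hl) !tlift_tmap//.
  rewrite -[in RHS](hcounitr a) (linear_tlift _ _ hxi)//.
  rewrite [X in _ + X](_ : _ = 0) ?addr0.
    by apply: tlift_ext => u v; rewrite (linear_scale hxi).
  rewrite [LHS]big1// => p _.
  by rewrite /dcounit /= (linear_0 hc) scale0r.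
- move=> a /=; rewrite dcomul_eta (linear_add hl) !tlift_tmap//.
  rewrite -[in RHS](hcounitr a) (linear_tlift _ _ heta)//.
  rewrite [X in X + _](_ : _ = 0) ?add0r.
    by apply: tlift_ext => u v; rewrite (linear_scale heta) /dcounit /= hom_counit.
  rewrite [LHS]big1// => p _.
  by rewrite /dcounit /= (linear_0 hc) scale0r.
Qed.

Fact dantipode_linear : linear dantipode.
Proof. by move=> c x y; congr pair; rewrite /= hantipode_linear// hom_linear. Qed.

Let Sxi a : dantipode (xi a) = xi (hantipode a).
Proof. by congr pair; rewrite /= (linear_0 hS) (linear_0 hth). Qed.
Let Seta a : dantipode (eta a) = eta (theta (hantipode a)).
Proof. by congr pair; rewrite /= (linear_0 hS). Qed.

Let tlift0 (V W U : lmodType C) (b : V -> W -> U) t :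
  (forall v w, b v w = 0) -> tlift b t = 0.
Proof. by move=> h; apply: big1 => p _; rewrite h. Qed.

Fact dantipodel x :
  tlift (fun a b => dantipode a * b) (dcomul x) = dcounit x *: 1.
Proof.
have hb : bilin (fun a b : D => dantipode a * b).
  exact: (bilin_comp (@bilin_mul C D) dantipode_linear (@linear_id _ _)).
have hbA : bilin (fun a b : A => hantipode a * b).
  exact: (bilin_comp (@bilin_mul C A) hS (@linear_id _ _)).
have hl := bilin_tlift hb.
move: x; apply: (double_lext (f := tlift _ \o dcomul)
                             (g := fun x => dcounit x *: 1)) => //.
- exact: (linear_comp hl dcomul_linear).
- by move=> c x y; rewrite dcounit_scalar scalerDl scalerA.
- move=> a /=; rewrite dcomul_xi (linear_add hl) !tlift_tmap//.
  rewrite double1 scalerDr -(linear_scale hxi) -(linear_scale heta).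
  rewrite -{2}(hom1 theta) -[_ *: theta 1](linear_scale hth) -hantipodel.
  rewrite -[eta (theta _)]/((eta \o theta) _).
  rewrite (linear_tlift _ _ hxi)// (linear_tlift _ _ hetath)//.
  congr (_ + _); apply: tlift_ext => u v; first by rewrite Sxi dxiM.
  by rewrite Seta detaM /= homM.
- move=> a /=; rewrite dcomul_eta (linear_add hl) !tlift_tmap//.
  rewrite !tlift0 ?addr0 /dcounit /= ?(linear_0 hc) ?scale0r// => u v.
    by rewrite Seta deta_xi.
  by rewrite Sxi dxi_eta.
Qed.

Fact dantipoder x :
  tlift (fun a b => a * dantipode b) (dcomul x) = dcounit x *: 1.
Proof.
have hb : bilin (fun a b : D => a * dantipode b).
  exact: (bilin_comp (@bilin_mul C D) (@linear_id _ _) dantipode_linear).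
have hbA : bilin (fun a b : A => a * hantipode b).
  exact: (bilin_comp (@bilin_mul C A) (@linear_id _ _) hS).
have hl := bilin_tlift hb.
move: x; apply: (double_lext (f := tlift _ \o dcomul)
                             (g := fun x => dcounit x *: 1)) => //.
- exact: (linear_comp hl dcomul_linear).
- by move=> c x y; rewrite dcounit_scalar scalerDl scalerA.
- move=> a /=; rewrite dcomul_xi (linear_add hl) !tlift_tmap//.
  rewrite double1 scalerDr -(linear_scale hxi) -(linear_scale heta).
  rewrite -hantipoder (linear_tlift _ _ hxi)// (linear_tlift _ _ heta)//.
  congr (_ + _); apply: tlift_ext => u v; first by rewrite Sxi dxiM.
  by rewrite Seta detaM -hom_antipode thetaK.
- move=> a /=; rewrite dcomul_eta (linear_add hl) !tlift_tmap//.
  rewrite !tlift0 ?addr0 /dcounit /= ?(linear_0 hc) ?scale0r// => u v.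
    by rewrite Sxi deta_xi.
  by rewrite Seta dxi_eta.
Qed.

End DoublingAlgebra.

Definition doubling (A : hopfStarAlgebra C) (theta : hopfStarHom A A)
    (thetaK : involutive theta) : hopfStarAlgebra C :=
  HopfStarAlgebra (@dstarK A) (@dstar_antilinear A) (@dstarM A)
    (dcomul_linear theta) (dcomulM theta) (dcomul1 theta) (dcomul_star theta)
    (dcomulA thetaK) (@dcounit_scalar A) (@dcounitM A) (@dcounit1 A)
    (dcounitl theta) (dcounitr theta)
    (dantipode_linear theta) (dantipodel theta) (dantipoder thetaK).

Section DoublingHom.
Variables (A B : hopfStarAlgebra C).
Variables (thetaA : hopfStarHom A A) (thetaB : hopfStarHom B B).
Hypotheses (thetaAK : involutive thetaA) (thetaBK : involutive thetaB).
Variable f : hopfStarHom A B.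
Hypothesis f_theta : forall x, f (thetaA x) = thetaB (f x).

Definition dmap (p : doubling thetaAK) : doubling thetaBK := (f p.1, f p.2).

Fact dmap_linear : linear dmap.
Proof. by move=> c x y; congr pair; rewrite /= hom_linear. Qed.
Fact dmapM x y : dmap (x * y) = dmap x * dmap y.
Proof. by congr pair; rewrite /= homM. Qed.
Fact dmap1 : dmap 1 = 1.
Proof. by congr pair; rewrite /= hom1. Qed.
Fact dmap_star x : dmap (hstar x) = hstar (dmap x).
Proof. by congr pair; rewrite /= hom_star. Qed.

Fact dmap_comul x : hcomul (dmap x) = tmap dmap dmap (hcomul x).
Proof.
have hf := hom_linear f; have f0 := linear_0 hf; have hd := dmap_linear.
have hA := hom_linear thetaA; have hB := hom_linear thetaB.
have xA := @dxi_linear A; have xB := @dxi_linear B.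
have eA := @deta_linear A; have eB := @deta_linear B.
have xtA := linear_comp xA hA; have xtB := linear_comp xB hB.
have etA := linear_comp eA hA; have etB := linear_comp eB hB.
have td := linear_add (tmap_linear hd hd).
have fx a : dmap (dxi a) = dxi (f a) by congr pair.
have fe a : dmap (deta a) = deta (f a) by congr pair.
rewrite [RHS]/= /dcomul !td [LHS]/= /dcomul /= !hom_comul.
by congr (_ + _ + (_ + _)); rewrite !tmap_comp//; apply: tmap_ext => a /=;
  rewrite ?fx ?fe ?f_theta.
Qed.

Definition doubling_hom : hopfStarHom (doubling thetaAK) (doubling thetaBK) :=
  HopfStarHom dmap_linear dmapM dmap1 dmap_star dmap_comul.

End DoublingHom.
End Doubling.
Arguments doubling_hom {C A B thetaA thetaB} thetaAK thetaBK f f_theta.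

(** * The Hopf *-algebra of a finite group *)

(* The functions on G, with the convolution product; gpt g is the group element
   g, with comultiplication gpt g ⊗ gpt g. *)
Definition groupAlg (C : numClosedFieldType) (G : finGroupType) := {ffun G -> C}.

Section GroupAlgebra.
Variables (C : numClosedFieldType) (G : finGroupType).
Local Notation A := (groupAlg C G).

HB.instance Definition _ := GRing.Lmodule.copy A {ffun G -> C^o}.

Definition gpt (g : G) : A := [ffun x => (x == g)%:R].
Definition gmul (a b : A) : A := [ffun x => \sum_y a y * b (y^-1 * x)%g].

Fact gmulA : associative gmul.
Proof.
move=> a b c; apply/ffunP => x; rewrite !ffunE.
under [RHS]eq_bigr do rewrite ffunE mulr_suml.
rewrite exchange_big /=; apply: eq_bigr => z _; rewrite ffunE mulr_sumr.
rewrite [RHS](reindex_inj (mulgI z)) /=; apply: eq_bigr => w _.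
by rewrite mulrA mulKg invMg mulgA.
Qed.
Fact gmul1l : left_id (gpt 1%g) gmul.
Proof.
move=> a; apply/ffunP => x; rewrite !ffunE (bigD1 1%g)//= ffunE eqxx mul1r.
rewrite invg1 mul1g big1 ?addr0// => y /negbTE hy.
by rewrite ffunE hy mul0r.
Qed.
Fact gmul1r : right_id (gpt 1%g) gmul.
Proof.
move=> a; apply/ffunP => x; rewrite !ffunE (bigD1 x)//= ffunE mulVg eqxx mulr1.
rewrite big1 ?addr0// => y hy.
by rewrite ffunE -eq_invg_mul invgK (negbTE hy) mulr0.
Qed.
Fact gmulDl : left_distributive gmul +%R.
Proof.
move=> a b c; apply/ffunP => x; rewrite !ffunE -big_split /=.
by apply: eq_bigr => y _; rewrite ffunE mulrDl.
Qed.
Fact gmulDr : right_distributive gmul +%R.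
Proof.
move=> a b c; apply/ffunP => x; rewrite !ffunE -big_split /=.
by apply: eq_bigr => y _; rewrite ffunE mulrDr.
Qed.
Fact gone_neq0 : gpt 1%g != 0.
Proof. by apply/eqP => /ffunP /(_ 1%g); rewrite !ffunE eqxx; apply/eqP/oner_neq0. Qed.

HB.instance Definition _ := GRing.Zmodule_isNzRing.Build A
  gmulA gmul1l gmul1r gmulDl gmulDr gone_neq0.

Fact gscaleAl (c : C) (a b : A) : c *: (a * b) = (c *: a) * b.
Proof.
apply/ffunP => x; rewrite !ffunE /GRing.scale /= mulr_sumr.
by apply: eq_bigr => y _; rewrite ffunE mulrA.
Qed.
HB.instance Definition _ := GRing.Lmodule_isLalgebra.Build C A gscaleAl.
Fact gscaleAr (c : C) (a b : A) : c *: (a * b) = a * (c *: b).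
Proof.
apply/ffunP => x; rewrite !ffunE /GRing.scale /= mulr_sumr.
by apply: eq_bigr => y _; rewrite ffunE mulrCA.
Qed.
HB.instance Definition _ := GRing.Lalgebra_isAlgebra.Build C A gscaleAr.

Lemma gptE (a : A) : a = \sum_g a g *: gpt g.
Proof.
apply/ffunP => x; rewrite sum_ffunE (bigD1 x)//= big1 ?addr0 => [|y hy].
  by rewrite !ffunE eqxx /GRing.scale /= mulr1.
by rewrite !ffunE eq_sym (negbTE hy) /GRing.scale /= mulr0.
Qed.

Lemma gptM g h : gpt g * gpt h = gpt (g * h)%g.
Proof.
apply/ffunP => x; rewrite !ffunE (bigD1 g)//= big1 ?addr0 => [|y /negbTE hy].
  rewrite !ffunE eqxx mul1r; congr (_ %:R); congr nat_of_bool.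
  by apply/eqP/eqP => [<-|->]; rewrite ?mulKVg ?mulKg.
by rewrite !ffunE hy mul0r.
Qed.

Lemma linear_sum_ (V W : lmodType C) (f : V -> W) (I : finType) (F : I -> V) :
  linear f -> f (\sum_i F i) = \sum_i f (F i).
Proof. by move=> hf; elim/big_rec2: _ => [|x u v _ <-]; rewrite ?linear_0 ?linear_add. Qed.

Lemma gpt_lext (V : lmodType C) (f g : A -> V) : linear f -> linear g ->
  (forall x, f (gpt x) = g (gpt x)) -> f =1 g.
Proof.
move=> hf hg h a; rewrite [a]gptE !linear_sum_//.
by apply: eq_bigr => x _; rewrite (linear_scale hf) (linear_scale hg) h.
Qed.

Definition gstar (a : A) : A := [ffun x => (a x^-1%g)^*].
Definition gcomul (a : A) : A ⊗ A := \sum_g a g *: (gpt g ⊗ gpt g).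
Definition gcounit (a : A) : C := \sum_g a g.
Definition gantipode (a : A) : A := [ffun x => a x^-1%g].

Lemma glin_ (V : lmodType C) (F : G -> V) : linear (fun a : A => \sum_g a g *: F g).
Proof.
move=> c a b; rewrite scaler_sumr -big_split /=; apply: eq_bigr => g _.
by rewrite !ffunE scalerDl scalerA.
Qed.

Lemma glin_gpt (V : lmodType C) (F : G -> V) h : \sum_g gpt h g *: F g = F h.
Proof.
rewrite (bigD1 h)//= ffunE eqxx scale1r big1 ?addr0// => g /negbTE hg.
by rewrite ffunE hg scale0r.
Qed.

Fact gcomul_linear : linear gcomul. Proof. exact: glin_. Qed.
Lemma gcomul_gpt g : gcomul (gpt g) = gpt g ⊗ gpt g.
Proof. exact: glin_gpt. Qed.

Let gcounitE (a : A) : gcounit a = \sum_g a g *: (1 : C^o).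
Proof. by apply: eq_bigr => g _; rewrite /GRing.scale /= mulr1. Qed.
Fact gcounit_scalar : scalar gcounit.
Proof. by move=> c a b; rewrite !gcounitE; apply: (glin_ (fun=> 1 : C^o)). Qed.
Lemma gcounit_gpt g : gcounit (gpt g) = 1.
Proof. by rewrite gcounitE; apply: (glin_gpt (fun=> 1 : C^o)). Qed.

Fact gantipode_linear : linear gantipode.
Proof. by move=> c a b; apply/ffunP => x; rewrite !ffunE. Qed.
Lemma gantipode_gpt g : gantipode (gpt g) = gpt g^-1%g.
Proof. by apply/ffunP => x; rewrite !ffunE eqg_invLR. Qed.

Fact gstarK : involutive gstar.
Proof. by move=> a; apply/ffunP => x; rewrite !ffunE invgK conjCK. Qed.
Fact gstar_antilinear c a b : gstar (c *: a + b) = c^* *: gstar a + gstar b.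
Proof. by apply/ffunP => x; rewrite !ffunE rmorphD rmorphM. Qed.
Lemma gstar_gpt g : gstar (gpt g) = gpt g^-1%g.
Proof. by apply/ffunP => x; rewrite !ffunE eqg_invLR conjC_nat. Qed.

Lemma gpt_bilext (V : lmodType C) (f g : A -> A -> V) : bilin f -> bilin g ->
  (forall x y, f (gpt x) (gpt y) = g (gpt x) (gpt y)) -> forall a b, f a b = g a b.
Proof.
move=> [fl fr] [gl gr] h a b; move: a; apply: (gpt_lext (f := f^~ b)) => // x.
by move: b; apply: gpt_lext.
Qed.

Fact gstarM a b : gstar (a * b) = gstar b * gstar a.
Proof.
apply/ffunP => x; rewrite !ffunE rmorph_sum /=.
rewrite [RHS](reindex_inj (mulgI x)) /=.
apply: eq_bigr => y _; rewrite !ffunE rmorphM mulrC.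
by rewrite !invMg !invgK mulgA mulVg mul1g.
Qed.

Fact gcomulM a b : gcomul (a * b) = tmul (gcomul a) (gcomul b).
Proof.
move: a b; apply: gpt_bilext.
- exact: (bilin_compl (@bilin_mul C A) gcomul_linear).
- exact: (bilin_comp (@tmul_bilin C A A) gcomul_linear gcomul_linear).
- by move=> x y; rewrite gptM !gcomul_gpt tmulE gptM.
Qed.

Fact gcomul1 : gcomul 1 = 1 ⊗ 1.
Proof. exact: gcomul_gpt. Qed.

Fact gcomul_star a : gcomul (gstar a) = tmap gstar gstar (gcomul a).
Proof.
have hs : antilinear gstar by exact: gstar_antilinear.
have e : tmap gstar gstar (gcomul a) =
    \sum_g (a g)^* *: (gpt g^-1%g ⊗ gpt g^-1%g).
  rewrite /gcomul.
  elim/big_rec2: _ => [|g t u _ e].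
    by apply: (addrI (tmap gstar gstar 0)); rewrite -(tmap_antiD hs hs) !addr0.
  rewrite (tmap_antiD hs hs) -e -tensZl (tmap_antiE hs hs).
  by rewrite (antilinearZ _ _ hs) tensZl gstar_gpt.
rewrite e /gcomul (reindex_inj invg_inj) /=.
by apply: eq_bigr => g _; rewrite ffunE invgK.
Qed.

Fact gcomulA a : tassoc (tmap gcomul id (gcomul a)) = tmap id gcomul (gcomul a).
Proof.
have hc := gcomul_linear; have hid := @linear_id C A.
move: a; apply: (gpt_lext (f := @tassoc C A A A \o (tmap gcomul id \o gcomul))
                          (g := tmap id gcomul \o gcomul)).
- apply: (linear_comp (@tassoc_linear C A A A)); apply: linear_comp => //.
  exact: tmap_linear.
- by apply: linear_comp => //; apply: tmap_linear.
- by move=> g /=; rewrite !gcomul_gpt !tmapE// !gcomul_gpt tassocE.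
Qed.

Fact gcounitM : {morph gcounit : x y / x * y}.
Proof.
have hc : linear (gcounit : A -> C^o) by exact: gcounit_scalar.
move=> a b; move: a b.
apply: (gpt_bilext (f := fun a b => gcounit (a * b) : C^o)).
- exact: (bilin_compl (@bilin_mul C A) hc).
- exact: (bilin_comp (@bilin_mul C C^o) hc hc).
- by move=> x y; rewrite gptM !gcounit_gpt mulr1.
Qed.
Fact gcounit1 : gcounit 1 = 1. Proof. exact: gcounit_gpt. Qed.

Fact gcounitl a : tlift (fun a b => gcounit a *: b) (gcomul a) = a.
Proof.
have hc : linear (gcounit : A -> C^o) by exact: gcounit_scalar.
have hb : bilin (fun a b : A => gcounit a *: b).
  exact: (bilin_comp (@bilin_scale C A) hc (@linear_id _ _)).
move: a; apply: (gpt_lext (f := tlift _ \o gcomul) (g := id)) => //.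
- exact: (linear_comp (bilin_tlift hb) gcomul_linear).
- by move=> g; rewrite /= gcomul_gpt tlift_bilin// gcounit_gpt scale1r.
Qed.

Fact gcounitr a : tlift (fun a b => gcounit b *: a) (gcomul a) = a.
Proof.
have hb : bilin (fun a b : A => gcounit b *: a).
  split=> [w|v] c y z /=; first by rewrite scalerDr !scalerA mulrC.
  by rewrite gcounit_scalar scalerDl scalerA.
move: a; apply: (gpt_lext (f := tlift _ \o gcomul) (g := id)) => //.
- exact: (linear_comp (bilin_tlift hb) gcomul_linear).
- by move=> g; rewrite /= gcomul_gpt tlift_bilin// gcounit_gpt scale1r.
Qed.

Let gcounit_lin1 : linear (fun a : A => gcounit a *: (1 : A)).
Proof. by move=> c a b; rewrite gcounit_scalar scalerDl scalerA. Qed.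

Fact gantipodel a :
  tlift (fun a b => gantipode a * b) (gcomul a) = gcounit a *: 1.
Proof.
have hb : bilin (fun a b : A => gantipode a * b).
  exact: (bilin_comp (@bilin_mul C A) gantipode_linear (@linear_id _ _)).
move: a; apply: (gpt_lext (f := tlift _ \o gcomul) _ gcounit_lin1).
- exact: (linear_comp (bilin_tlift hb) gcomul_linear).
- move=> g; rewrite /= gcomul_gpt tlift_bilin// gcounit_gpt scale1r.
  by rewrite gantipode_gpt gptM mulVg.
Qed.

Fact gantipoder a :
  tlift (fun a b => a * gantipode b) (gcomul a) = gcounit a *: 1.
Proof.
have hb : bilin (fun a b : A => a * gantipode b).
  exact: (bilin_comp (@bilin_mul C A) (@linear_id _ _) gantipode_linear).
move: a; apply: (gpt_lext (f := tlift _ \o gcomul) _ gcounit_lin1).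
- exact: (linear_comp (bilin_tlift hb) gcomul_linear).
- move=> g; rewrite /= gcomul_gpt tlift_bilin// gcounit_gpt scale1r.
  by rewrite gantipode_gpt gptM mulgV.
Qed.

End GroupAlgebra.

Definition groupHopf (C : numClosedFieldType) (G : finGroupType) :
    hopfStarAlgebra C :=
  HopfStarAlgebra (@gstarK C G) (@gstar_antilinear C G) (@gstarM C G)
    (@gcomul_linear C G) (@gcomulM C G) (@gcomul1 C G) (@gcomul_star C G)
    (@gcomulA C G) (@gcounit_scalar C G) (@gcounitM C G) (@gcounit1 C G)
    (@gcounitl C G) (@gcounitr C G) (@gantipode_linear C G)
    (@gantipodel C G) (@gantipoder C G).

Section GroupHom.
Variables (C : numClosedFieldType) (G H : finGroupType) (f : G -> H).
Hypothesis fM : {morph f : x y / (x * y)%g}.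

Let f1 : f 1%g = 1%g.
Proof. by apply: (mulgI (f 1%g)); rewrite -fM !mulg1. Qed.
Let fV x : f x^-1%g = (f x)^-1%g.
Proof. by apply: (mulgI (f x)); rewrite -fM !mulgV f1. Qed.

Definition gmap (a : groupHopf C G) : groupHopf C H :=
  \sum_g (a : groupAlg C G) g *: gpt C (f g).

Fact gmap_linear : linear gmap. Proof. exact: glin_. Qed.
Lemma gmap_gpt g : gmap (gpt C g) = gpt C (f g). Proof. exact: glin_gpt. Qed.

Fact gmapM x y : gmap (x * y) = gmap x * gmap y.
Proof.
have hm := gmap_linear; move: x y; apply: gpt_bilext.
- exact: (bilin_compl (@bilin_mul C _) hm).
- exact: (bilin_comp (@bilin_mul C _) hm hm).
- by move=> x y; rewrite gptM !gmap_gpt gptM fM.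
Qed.
Fact gmap1 : gmap 1 = 1.
Proof. by rewrite gmap_gpt f1. Qed.
Fact gmap_star x : gmap (hstar x) = hstar (gmap x).
Proof.
have hs := @gstar_antilinear C H.
rewrite /gmap (reindex_inj invg_inj) /=.
have -> : gstar (\sum_g (x : groupAlg C G) g *: gpt C (f g)) =
    \sum_g ((x : groupAlg C G) g)^* *: gpt C (f g)^-1%g.
  elim/big_rec2: _ => [|g t u _ <-]; first exact: (antilinear0 hs).
  by rewrite hs gstar_gpt.
by apply: eq_bigr => g _; rewrite ffunE invgK fV.
Qed.
Fact gmap_comul x : hcomul (gmap x) = tmap gmap gmap (hcomul x).
Proof.
have hm := gmap_linear.
move: x; apply: (gpt_lext (f := hcomul (h := groupHopf C H) \o gmap)
  (g := tmap gmap gmap \o hcomul (h := groupHopf C G))).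
- exact: (linear_comp (@gcomul_linear C H)).
- exact: (linear_comp (tmap_linear hm hm) (@gcomul_linear C G)).
- by move=> g /=; rewrite gmap_gpt !gcomul_gpt tmapE// gmap_gpt.
Qed.

Definition groupHopf_hom : hopfStarHom (groupHopf C G) (groupHopf C H) :=
  HopfStarHom gmap_linear gmapM gmap1 gmap_star gmap_comul.

End GroupHom.

Lemma gmap_comp (C : numClosedFieldType) (G H K : finGroupType)
    (f : G -> H) (g : H -> K) (a : groupHopf C G) :
  gmap g (gmap f a) = gmap (g \o f) a.
Proof.
move: a; apply: (gpt_lext (f := gmap g \o gmap f)).
- exact: (linear_comp (@gmap_linear C _ _ g) (@gmap_linear C _ _ f)).
- exact: gmap_linear.
- by move=> x; rewrite /= !gmap_gpt.
Qed.

Lemma gmap_id (C : numClosedFieldType) (G : finGroupType) (a : groupHopf C G) :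
  gmap id a = a.
Proof. by rewrite /gmap -gptE. Qed.

(** * Inductive limits of sequences of Hopf *-algebras *)

Record hopfSystem (C : numClosedFieldType) := HopfSystem {
  sys_obj :> nat -> hopfStarAlgebra C;
  sys_map : forall n, hopfStarHom (sys_obj n) (sys_obj n.+1)
}.

Section Thread.
Variables (C : numClosedFieldType) (S : hopfSystem C).
Local Notation phi := (@sys_map C S).

Definition coherent_from (N : nat) (x : forall n, S n) :=
  forall n, (N <= n)%N -> x n.+1 = phi n (x n).

Record thread := Thread {
  thread_fun :> forall n, S n;
  threadP : exists N, coherent_from N thread_fun
}.

HB.instance Definition _ := gen_eqMixin thread.
HB.instance Definition _ := gen_choiceMixin thread.

Definition eventually_eq (x y : thread) : bool :=
  `[< exists N, forall n, (N <= n)%N -> x n = y n >].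

Fact eventually_eq_refl : reflexive eventually_eq.
Proof. by move=> x; apply/asboolP; exists 0%N. Qed.
Fact eventually_eq_sym : symmetric eventually_eq.
Proof.
by move=> x y; apply/asboolP/asboolP => -[N h]; exists N => n /h.
Qed.
Fact eventually_eq_trans : transitive eventually_eq.
Proof.
move=> y x z /asboolP[N h] /asboolP[M h']; apply/asboolP; exists (maxn N M) => n.
by rewrite geq_max => /andP[/h -> /h' ->].
Qed.
Canonical eventually_eq_equiv :=
  EquivRel eventually_eq eventually_eq_refl eventually_eq_sym eventually_eq_trans.

(* The inductive limit of S_0 -> S_1 -> S_2 -> ... : sequences (x_n) with
   x_n in S_n and x_(n+1) = phi_n(x_n) for all large n, two of them being
   identified when they agree for all large n. See dirlim_universal below. *)
Definition limAlg := {eq_quot eventually_eq}.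
HB.instance Definition _ := Choice.on limAlg.

Lemma coherent_le N M x : coherent_from N x -> (N <= M)%N -> coherent_from M x.
Proof. by move=> h NM n Mn; apply/h/(leq_trans NM). Qed.

Lemma coherent_eq N (x y : forall n, S n) :
  coherent_from N x -> coherent_from N y -> x N = y N ->
  forall n, (N <= n)%N -> x n = y n.
Proof.
move=> hx hy e n /subnKC <-; elim: (n - N)%N => [|k IH]; rewrite ?addn0//.
by rewrite addnS hx ?leq_addr// hy ?leq_addr// IH.
Qed.

Lemma thread2P (x y : thread) :
  exists N, coherent_from N x /\ coherent_from N y.
Proof.
have [N hN] := threadP x; have [M hM] := threadP y; exists (maxn N M).
by split; [apply: coherent_le hN _|apply: coherent_le hM _];
  rewrite ?leq_maxl ?leq_maxr.
Qed.

Lemma pi_eq (x y : thread) N : (forall n, (N <= n)%N -> x n = y n) ->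
  \pi_limAlg x = \pi_limAlg y.
Proof. by move=> h; apply/eqmodP/asboolP; exists N. Qed.

Lemma pi_eqP (x y : thread) : \pi_limAlg x = \pi_limAlg y ->
  exists N, forall n, (N <= n)%N -> x n = y n.
Proof. by move/eqmodP/asboolP. Qed.

Fact th_cst_subproof (f : forall n, S n) :
  (forall n, phi n (f n) = f n.+1) -> exists N, coherent_from N f.
Proof. by move=> h; exists 0%N => n _; rewrite h. Qed.
Fact th_un_subproof (f : forall n, S n -> S n) (x : thread) :
  (forall n a, phi n (f n a) = f n.+1 (phi n a)) ->
  exists N, coherent_from N (fun n => f n (x n)).
Proof.
by move=> h; have [N hN] := threadP x; exists N => n Nn; rewrite h hN.
Qed.
Fact th_bin_subproof (f : forall n, S n -> S n -> S n) (x y : thread) :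
  (forall n a b, phi n (f n a b) = f n.+1 (phi n a) (phi n b)) ->
  exists N, coherent_from N (fun n => f n (x n) (y n)).
Proof.
move=> h; have [N [hx hy]] := thread2P x y.
by exists N => n Nn; rewrite h hx// hy.
Qed.

Lemma phi0 n : phi n 0 = 0. Proof. exact/linear_0/hom_linear. Qed.
Lemma phiD n a b : phi n (a + b) = phi n a + phi n b.
Proof. exact: (linear_add (hom_linear (phi n))). Qed.
Lemma phiZ c n a : phi n (c *: a) = c *: phi n a.
Proof. exact: (linear_scale (hom_linear (phi n))). Qed.
Lemma phiN n a : phi n (- a) = - phi n a.
Proof. by rewrite -scaleN1r phiZ scaleN1r. Qed.

Definition th0 := Thread (th_cst_subproof phi0).
Definition th1 := Thread (th_cst_subproof (fun n => hom1 (phi n))).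
Definition thN x := Thread (th_un_subproof x phiN).
Definition thZ c x := Thread (th_un_subproof x (phiZ c)).
Definition thD x y := Thread (th_bin_subproof x y phiD).
Definition thM x y := Thread (th_bin_subproof x y (fun n => homM (phi n))).

Definition lim0 : limAlg := \pi_limAlg th0.
Definition lim1 : limAlg := \pi_limAlg th1.
Definition limN (u : limAlg) : limAlg := \pi_limAlg (thN (repr u)).
Definition limZ (c : C) (u : limAlg) : limAlg := \pi_limAlg (thZ c (repr u)).
Definition limD (u v : limAlg) : limAlg := \pi_limAlg (thD (repr u) (repr v)).
Definition limM (u v : limAlg) : limAlg := \pi_limAlg (thM (repr u) (repr v)).

Lemma pi_repr (x : thread) :
  exists N, forall n, (N <= n)%N -> repr (\pi_limAlg x) n = x n.
Proof. by apply: pi_eqP; rewrite reprK. Qed.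

Lemma limN_pi x : limN (\pi_limAlg x) = \pi_limAlg (thN x).
Proof.
by have [N h] := pi_repr x; apply: (@pi_eq _ _ N) => n Nn; rewrite /= h.
Qed.
Lemma limZ_pi c x : limZ c (\pi_limAlg x) = \pi_limAlg (thZ c x).
Proof.
by have [N h] := pi_repr x; apply: (@pi_eq _ _ N) => n Nn; rewrite /= h.
Qed.
Lemma limD_pi x y : limD (\pi_limAlg x) (\pi_limAlg y) = \pi_limAlg (thD x y).
Proof.
have [N h] := pi_repr x; have [M h'] := pi_repr y.
apply: (@pi_eq _ _ (maxn N M)) => n; rewrite geq_max => /andP[Nn Mn] /=.
by rewrite h// h'.
Qed.
Lemma limM_pi x y : limM (\pi_limAlg x) (\pi_limAlg y) = \pi_limAlg (thM x y).
Proof.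
have [N h] := pi_repr x; have [M h'] := pi_repr y.
apply: (@pi_eq _ _ (maxn N M)) => n; rewrite geq_max => /andP[Nn Mn] /=.
by rewrite h// h'.
Qed.

Lemma limW (P : limAlg -> Prop) : (forall x, P (\pi_limAlg x)) -> forall u, P u.
Proof. by move=> h u; rewrite -[u]reprK. Qed.

Fact limDA : associative limD.
Proof.
elim/limW=> x; elim/limW=> y; elim/limW=> z; rewrite !limD_pi.
by apply: (@pi_eq _ _ 0%N) => n _ /=; rewrite addrA.
Qed.
Fact limDC : commutative limD.
Proof.
elim/limW=> x; elim/limW=> y; rewrite !limD_pi.
by apply: (@pi_eq _ _ 0%N) => n _ /=; rewrite addrC.
Qed.
Fact lim0D : left_id lim0 limD.
Proof.
elim/limW=> x; rewrite !limD_pi.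
by apply: (@pi_eq _ _ 0%N) => n _ /=; rewrite add0r.
Qed.
Fact limND : left_inverse lim0 limN limD.
Proof.
elim/limW=> x; rewrite limN_pi !limD_pi.
by apply: (@pi_eq _ _ 0%N) => n _ /=; rewrite addNr.
Qed.

HB.instance Definition _ := GRing.isZmodule.Build limAlg limDA limDC lim0D limND.

Let piD x y : (\pi_limAlg x : limAlg) + (\pi_limAlg y : limAlg) = \pi_limAlg (thD x y).
Proof. exact: limD_pi. Qed.

Fact limMA : associative limM.
Proof.
elim/limW=> x; elim/limW=> y; elim/limW=> z; rewrite !limM_pi.
by apply: (@pi_eq _ _ 0%N) => n _ /=; rewrite mulrA.
Qed.
Fact lim1M : left_id lim1 limM.
Proof.
elim/limW=> x; rewrite !limM_pi.
by apply: (@pi_eq _ _ 0%N) => n _ /=; rewrite mul1r.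
Qed.
Fact limM1 : right_id lim1 limM.
Proof.
elim/limW=> x; rewrite !limM_pi.
by apply: (@pi_eq _ _ 0%N) => n _ /=; rewrite mulr1.
Qed.
Fact limMDl : left_distributive limM +%R.
Proof.
elim/limW=> x; elim/limW=> y; elim/limW=> z; rewrite !(piD, limM_pi) ?piD.
by apply: (@pi_eq _ _ 0%N) => n _ /=; rewrite mulrDl.
Qed.
Fact limMDr : right_distributive limM +%R.
Proof.
elim/limW=> x; elim/limW=> y; elim/limW=> z; rewrite !(piD, limM_pi) ?piD.
by apply: (@pi_eq _ _ 0%N) => n _ /=; rewrite mulrDr.
Qed.
Fact lim1_neq0 : lim1 != 0.
Proof.
apply/eqP => /pi_eqP[N /(_ N (leqnn N))] /= /eqP.
by apply/negP/oner_neq0.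
Qed.

HB.instance Definition _ := GRing.Zmodule_isNzRing.Build limAlg
  limMA lim1M limM1 limMDl limMDr lim1_neq0.

Fact limZA c d u : limZ c (limZ d u) = limZ (c * d) u.
Proof.
elim/limW: u => x; rewrite !limZ_pi.
by apply: (@pi_eq _ _ 0%N) => n _ /=; rewrite scalerA.
Qed.
Fact limZ1 : left_id 1 limZ.
Proof.
elim/limW=> x; rewrite !limZ_pi.
by apply: (@pi_eq _ _ 0%N) => n _ /=; rewrite scale1r.
Qed.
Fact limZDr : right_distributive limZ +%R.
Proof.
move=> c; elim/limW=> x; elim/limW=> y; rewrite !(piD, limZ_pi) ?piD.
by apply: (@pi_eq _ _ 0%N) => n _ /=; rewrite scalerDr.
Qed.
Fact limZDl u : {morph limZ^~ u : c d / c + d}.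
Proof.
move=> c d /=; elim/limW: u => x; rewrite !limZ_pi piD.
by apply: (@pi_eq _ _ 0%N) => n _ /=; rewrite scalerDl.
Qed.

HB.instance Definition _ :=
  GRing.Zmodule_isLmodule.Build C limAlg limZA limZ1 limZDr limZDl.

Let piZ c x : c *: (\pi_limAlg x : limAlg) = \pi_limAlg (thZ c x).
Proof. exact: limZ_pi. Qed.
Let piM x y : (\pi_limAlg x : limAlg) * (\pi_limAlg y : limAlg) = \pi_limAlg (thM x y).
Proof. exact: limM_pi. Qed.

Fact limZAl (c : C) (u v : limAlg) : c *: (u * v) = (c *: u) * v.
Proof.
elim/limW: u => x; elim/limW: v => y; rewrite piM !piZ piM.
by apply: (@pi_eq _ _ 0%N) => n _ /=; rewrite scalerAl.
Qed.
HB.instance Definition _ := GRing.Lmodule_isLalgebra.Build C limAlg limZAl.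
Fact limZAr (c : C) (u v : limAlg) : c *: (u * v) = u * (c *: v).
Proof.
elim/limW: u => x; elim/limW: v => y; rewrite piM !piZ piM.
by apply: (@pi_eq _ _ 0%N) => n _ /=; rewrite scalerAr.
Qed.
HB.instance Definition _ := GRing.Lalgebra_isAlgebra.Build C limAlg limZAr.

(* The canonical maps S_n -> limAlg: [from a] is the sequence
   0, ..., 0, a, phi_n(a), phi_(n+1)(phi_n(a)), ... *)
Definition place n (a : S n) m (b : S m) : S m :=
  if @eqP _ n m is ReflectT e then ecast k (S k) e a else b.

Lemma place_id n (a b : S n) : place a b = a.
Proof. by rewrite /place; case: eqP => // e; rewrite (eq_axiomK e). Qed.
Lemma place_neq n (a : S n) m (b : S m) : n != m -> place a b = b.
Proof. by rewrite /place; case: eqP. Qed.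

Fixpoint from n (a : S n) (m : nat) : S m :=
  if m is k.+1 then place a (phi k (from a k)) else place a 0.

Lemma from_id n (a : S n) : from a n = a.
Proof. by case: n a => [|n] a; apply: place_id. Qed.

Lemma from_coherent n (a : S n) : coherent_from n (from a).
Proof. by move=> m nm /=; rewrite place_neq// neq_ltn ltnS nm. Qed.

Definition th_in n (a : S n) : thread := Thread (ex_intro _ n (from_coherent a)).
Definition lim_in n (a : S n) : limAlg := \pi_limAlg (th_in a).

Lemma lim_in_pi (x : thread) N : coherent_from N x -> \pi_limAlg x = lim_in (x N).
Proof.
move=> hx; apply: (@pi_eq _ _ N) => n Nn /=.
by apply: (coherent_eq hx (from_coherent (x N))) => //; rewrite from_id.
Qed.

Lemma lim_in_map n (a : S n) : lim_in (phi n a) = lim_in a.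
Proof.
apply: (@pi_eq _ _ n.+1); apply: coherent_eq.
- exact: from_coherent.
- exact: (coherent_le (from_coherent a)).
- by rewrite /= place_id place_neq ?from_id// neq_ltn ltnSn.
Qed.

Lemma limP (u : limAlg) : exists n (a : S n), u = lim_in a.
Proof.
elim/limW: u => x; have [N hN] := threadP x.
by exists N, (x N); apply: lim_in_pi.
Qed.

Lemma lim2P (u v : limAlg) :
  exists n (a b : S n), u = lim_in a /\ v = lim_in b.
Proof.
elim/limW: u => x; elim/limW: v => y; have [N [hx hy]] := thread2P x y.
by exists N, (x N), (y N); split; apply: lim_in_pi.
Qed.

Lemma lim_inP n (x : thread) (a : S n) : coherent_from n x -> x n = a ->
  lim_in a = \pi_limAlg x.
Proof. by move=> hx <-; rewrite (lim_in_pi hx). Qed.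

Lemma lim_in_linear n : linear (@lim_in n).
Proof.
move=> c a b; have -> : c *: lim_in a + lim_in b =
    \pi_limAlg (thD (thZ c (th_in a)) (th_in b)).
  by rewrite /lim_in piZ piD.
apply: lim_inP => [m nm|]; last by rewrite /= !from_id.
rewrite -[LHS]/(c *: from a m.+1 + from b m.+1).
by rewrite (from_coherent a nm) (from_coherent b nm) phiD phiZ.
Qed.

Lemma lim_inM n (a b : S n) : lim_in (a * b) = lim_in a * lim_in b.
Proof.
have -> : lim_in a * lim_in b = \pi_limAlg (thM (th_in a) (th_in b)).
  by rewrite /lim_in piM.
apply: lim_inP => [m nm|]; last by rewrite /= !from_id.
rewrite -[LHS]/(from a m.+1 * from b m.+1).
by rewrite (from_coherent a nm) (from_coherent b nm) homM.
Qed.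

Lemma lim_in1 n : lim_in (1 : S n) = 1.
Proof. by apply: lim_inP => // m _ /=; rewrite hom1. Qed.

(* The map out of the limit induced by a compatible family of maps. *)
Definition lim_lift (X : Type) (T : forall n, S n -> X) (u : limAlg) : X :=
  T _ (repr u (projT1 (cid (threadP (repr u))))).

Lemma lim_liftE (X : Type) (T : forall n, S n -> X) n (a : S n) :
  (forall n a, T n.+1 (phi n a) = T n a) -> lim_lift T (lim_in a) = T n a.
Proof.
move=> hT; have key N x : coherent_from N x -> forall m, (N <= m)%N ->
    T m (x m) = T N (x N).
  move=> hx m /subnKC <-; elim: (m - N)%N => [|k IH]; first by rewrite addn0.
  by rewrite addnS hx ?leq_addr// hT.
rewrite /lim_lift; case: cid => N hN /=.
have [M hM] := pi_repr (Thread (ex_intro _ n (from_coherent a))).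
pose K := maxn N (maxn M n).
have NK : (N <= K)%N by rewrite leq_maxl.
have MK : (M <= K)%N by rewrite /K maxnCA leq_maxl.
have nK : (n <= K)%N by rewrite /K maxnA leq_maxr.
rewrite -(key _ _ hN K NK) (hM K MK) /= (key _ _ (from_coherent a) K nK).
by rewrite from_id.
Qed.

Definition lim_star : limAlg -> limAlg :=
  lim_lift (fun n a => lim_in (hstar a)).
Definition lim_comul : limAlg -> limAlg ⊗ limAlg :=
  lim_lift (fun n a => tmap (@lim_in n) (@lim_in n) (hcomul a)).
Definition lim_counit : limAlg -> C := lim_lift (fun n a => hcounit a).
Definition lim_antipode : limAlg -> limAlg :=
  lim_lift (fun n a => lim_in (hantipode a)).

Let iL := lim_in_linear.
Let hcL n : linear (@hcomul _ (S n)). Proof. exact: hcomul_linear. Qed.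
Let hSL n : linear (@hantipode _ (S n)). Proof. exact: hantipode_linear. Qed.

Lemma lim_starE n (a : S n) : lim_star (lim_in a) = lim_in (hstar a).
Proof. by apply: lim_liftE => m b; rewrite -hom_star lim_in_map. Qed.
Lemma lim_comulE n (a : S n) :
  lim_comul (lim_in a) = tmap (@lim_in n) (@lim_in n) (hcomul a).
Proof.
apply: (lim_liftE (T := fun n a => tmap (@lim_in n) (@lim_in n) (hcomul a))).
move=> m b; rewrite hom_comul tmap_comp; try exact: hom_linear; try exact: iL.
by apply: tmap_ext => c /=; rewrite lim_in_map.
Qed.
Lemma lim_counitE n (a : S n) : lim_counit (lim_in a) = hcounit a.
Proof.
by apply: (lim_liftE (T := fun n a => hcounit a)) => m b; rewrite hom_counit.
Qed.
Lemma lim_antipodeE n (a : S n) : lim_antipode (lim_in a) = lim_in (hantipode a).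
Proof.
by apply: lim_liftE => m b; rewrite -hom_antipode lim_in_map.
Qed.

Fact lim_starK : involutive lim_star.
Proof. by move=> u; have [n [a ->]] := limP u; rewrite !lim_starE hstarK. Qed.
Fact lim_star_antilinear c u v :
  lim_star (c *: u + v) = c^* *: lim_star u + lim_star v.
Proof.
have [n [a [b [-> ->]]]] := lim2P u v.
by rewrite -iL !lim_starE hstar_antilinear iL.
Qed.
Fact lim_starM u v : lim_star (u * v) = lim_star v * lim_star u.
Proof.
have [n [a [b [-> ->]]]] := lim2P u v.
by rewrite -lim_inM !lim_starE hstarM lim_inM.
Qed.
Fact lim_comul_linear : linear lim_comul.
Proof.
move=> c u v; have [n [a [b [-> ->]]]] := lim2P u v.
rewrite -iL !lim_comulE hcL.
by have h := tmap_linear (@iL n) (@iL n); rewrite h.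
Qed.
Fact lim_comulM u v : lim_comul (u * v) = tmul (lim_comul u) (lim_comul v).
Proof.
have [n [a [b [-> ->]]]] := lim2P u v.
rewrite -lim_inM !lim_comulE hcomulM; symmetry.
by apply: (tmul_tmap (@iL n) (@iL n) (@iL n) (@iL n) (@iL n) (@iL n)) => x y;
  rewrite lim_inM.
Qed.
Fact lim_comul1 : lim_comul 1 = 1 ⊗ 1.
Proof. by rewrite -(lim_in1 0) lim_comulE hcomul1 (tmapE (@iL 0%N) (@iL 0%N)) lim_in1. Qed.
Fact lim_comul_star u :
  lim_comul (lim_star u) = tmap lim_star lim_star (lim_comul u).
Proof.
have [n [a ->]] := limP u; rewrite lim_starE !lim_comulE hcomul_star.
have h1 : antilinear (@hstar _ (S n)) by exact: hstar_antilinear.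
have h2 : antilinear lim_star by exact: lim_star_antilinear.
by symmetry; apply: (tmap_anti_comm _ h2 h2 h1 h1 (@iL n) (@iL n) (@iL n) (@iL n)) => x;
  apply: lim_starE.
Qed.
Fact lim_comulA u :
  tassoc (tmap lim_comul id (lim_comul u)) = tmap id lim_comul (lim_comul u).
Proof.
have [n [a ->]] := limP u; rewrite !lim_comulE.
have hd := lim_comul_linear; have hid := @linear_id C (S n).
have hid' := @linear_id C limAlg.
have hi := @iL n; have hh := @hcL n.
have htt : linear (tmap (@lim_in n) (@lim_in n)) by apply: tmap_linear.
have e : lim_comul \o @lim_in n =1 tmap (@lim_in n) (@lim_in n) \o @hcomul _ (S n).
  by move=> x; apply: lim_comulE.
rewrite !tmap_comp// (tmap_ext _ e (frefl _)) (tmap_ext _ (frefl _) e).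
have -> : tmap (tmap (@lim_in n) (@lim_in n) \o @hcomul _ (S n)) (id \o @lim_in n) (hcomul a) =
    tmap (tmap (@lim_in n) (@lim_in n)) (@lim_in n) (tmap (@hcomul _ (S n)) id (hcomul a)).
  by rewrite tmap_comp.
have -> : tmap (id \o @lim_in n) (tmap (@lim_in n) (@lim_in n) \o @hcomul _ (S n)) (hcomul a) =
    tmap (@lim_in n) (tmap (@lim_in n) (@lim_in n)) (tmap id (@hcomul _ (S n)) (hcomul a)).
  by rewrite tmap_comp.
rewrite -hcomulA; move: (tmap (@hcomul _ (S n)) id _).
apply: (tensor3_lext
  (f := @tassoc C limAlg limAlg limAlg \o tmap (tmap (@lim_in n) (@lim_in n)) (@lim_in n))
  (g := tmap (@lim_in n) (tmap (@lim_in n) (@lim_in n)) \o @tassoc C (S n) (S n) (S n))).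
- by apply: linear_comp; [apply: tassoc_linear|apply: tmap_linear].
- by apply: linear_comp; [apply: tmap_linear|apply: tassoc_linear].
- by move=> x y z /=; rewrite tassocE !tmapE// tassocE.
Qed.
Fact lim_counit_scalar : scalar lim_counit.
Proof.
move=> c u v; have [n [a [b [-> ->]]]] := lim2P u v.
by rewrite -iL !lim_counitE hcounit_scalar.
Qed.
Fact lim_counitM : {morph lim_counit : u v / u * v}.
Proof.
move=> u v; have [n [a [b [-> ->]]]] := lim2P u v.
by rewrite -lim_inM !lim_counitE hcounitM.
Qed.
Fact lim_counit1 : lim_counit 1 = 1.
Proof. by rewrite -(lim_in1 0) lim_counitE hcounit1. Qed.

Fact lim_counitl u : tlift (fun a b => lim_counit a *: b) (lim_comul u) = u.
Proof.
have hc : linear (lim_counit : limAlg -> C^o) by exact: lim_counit_scalar.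
have [n [a ->]] := limP u; rewrite lim_comulE tlift_tmap; try exact: iL; last first.
  exact: (bilin_comp (@bilin_scale C limAlg) hc (@linear_id _ _)).
have hcn : linear (@hcounit _ (S n) : S n -> C^o) by exact: hcounit_scalar.
rewrite -[in RHS](hcounitl a) (linear_tlift _ _ (@iL n)).
  by apply: tlift_ext => x y; rewrite lim_counitE (linear_scale (@iL n)).
exact: (bilin_comp (@bilin_scale C (S n)) hcn (@linear_id _ _)).
Qed.
Fact lim_counitr u : tlift (fun a b => lim_counit b *: a) (lim_comul u) = u.
Proof.
have hbW (V : lmodType C) (e : V -> C) : scalar e -> bilin (fun a b : V => e b *: a).
  move=> he; split=> [w|v] c y z /=; first by rewrite scalerDr !scalerA mulrC.
  by rewrite he scalerDl scalerA.
have [n [a ->]] := limP u; rewrite lim_comulE tlift_tmap; try exact: iL; last first.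
  exact: (hbW limAlg _ lim_counit_scalar).
rewrite -[in RHS](hcounitr a) (linear_tlift _ _ (@iL n)).
  by apply: tlift_ext => x y; rewrite lim_counitE (linear_scale (@iL n)).
exact: (hbW (S n) _ (hcounit_scalar (h := S n))).
Qed.
Fact lim_antipode_linear : linear lim_antipode.
Proof.
move=> c u v; have [n [a [b [-> ->]]]] := lim2P u v.
by rewrite -iL !lim_antipodeE hantipode_linear iL.
Qed.
Fact lim_antipodel u :
  tlift (fun a b => lim_antipode a * b) (lim_comul u) = lim_counit u *: 1.
Proof.
have [n [a ->]] := limP u; rewrite lim_comulE tlift_tmap; try exact: iL; last first.
  exact: (bilin_comp (@bilin_mul C _) lim_antipode_linear (@linear_id _ _)).
rewrite lim_counitE -(lim_in1 n) -(linear_scale (@iL n)) -hantipodel.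
rewrite (linear_tlift _ _ (@iL n)).
  by apply: tlift_ext => x y; rewrite lim_antipodeE lim_inM.
exact: (bilin_comp (@bilin_mul C _) (@hSL n) (@linear_id _ _)).
Qed.
Fact lim_antipoder u :
  tlift (fun a b => a * lim_antipode b) (lim_comul u) = lim_counit u *: 1.
Proof.
have [n [a ->]] := limP u; rewrite lim_comulE tlift_tmap; try exact: iL; last first.
  exact: (bilin_comp (@bilin_mul C _) (@linear_id _ _) lim_antipode_linear).
rewrite lim_counitE -(lim_in1 n) -(linear_scale (@iL n)) -hantipoder.
rewrite (linear_tlift _ _ (@iL n)).
  by apply: tlift_ext => x y; rewrite lim_antipodeE lim_inM.
exact: (bilin_comp (@bilin_mul C _) (@linear_id _ _) (@hSL n)).
Qed.

End Thread.

Section DirectLimit.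
Variables (C : numClosedFieldType) (S : hopfSystem C).

Definition dirlim : hopfStarAlgebra C :=
  HopfStarAlgebra (@lim_starK C S) (@lim_star_antilinear C S) (@lim_starM C S)
    (@lim_comul_linear C S) (@lim_comulM C S) (@lim_comul1 C S)
    (@lim_comul_star C S) (@lim_comulA C S) (@lim_counit_scalar C S)
    (@lim_counitM C S) (@lim_counit1 C S) (@lim_counitl C S) (@lim_counitr C S)
    (@lim_antipode_linear C S) (@lim_antipodel C S) (@lim_antipoder C S).

Definition dirlim_in n : hopfStarHom (S n) dirlim :=
  @HopfStarHom C (S n) dirlim (@lim_in C S n) (@lim_in_linear C S n)
    (@lim_inM C S n) (@lim_in1 C S n)
    (fun x => esym (lim_starE x)) (@lim_comulE C S n).

Lemma dirlim_in_map n (a : S n) : dirlim_in n.+1 (sys_map S n a) = dirlim_in n a.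
Proof. exact: lim_in_map. Qed.

Theorem dirlim_universal (B : hopfStarAlgebra C)
    (g : forall n, hopfStarHom (S n) B) :
  (forall n a, g n.+1 (sys_map S n a) = g n a) ->
  exists h : hopfStarHom dirlim B,
    (forall n a, h (dirlim_in n a) = g n a) /\
    (forall h' : hopfStarHom dirlim B,
       (forall n a, h' (dirlim_in n a) = g n a) -> h' =1 h).
Proof.
move=> hg; pose h : dirlim -> B := lim_lift (fun n => g n).
have hE n a : h (lim_in a) = g n a by apply: (lim_liftE (T := fun n => g n)).
have h_linear : linear h.
  move=> c u v; have [n [a [b [-> ->]]]] := lim2P u v.
  by rewrite -lim_in_linear !hE hom_linear.
have hM u v : h (u * v) = h u * h v.
  have [n [a [b [-> ->]]]] := lim2P u v.
  by rewrite -lim_inM !hE homM.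
have h1 : h 1 = 1 by rewrite -(lim_in1 S 0) hE hom1.
have h_star u : h (hstar u) = hstar (h u).
  by have [n [a ->]] := limP u; rewrite /= lim_starE !hE hom_star.
have h_comul u : hcomul (h u) = tmap h h (hcomul u).
  have [n [a ->]] := limP u; rewrite /= lim_comulE hE hom_comul.
  rewrite tmap_comp; try exact: lim_in_linear; try exact: h_linear.
  by apply: tmap_ext => x /=; rewrite hE.
exists (HopfStarHom h_linear hM h1 h_star h_comul); split=> // h' e u.
by have [n [a ->]] := limP u; rewrite /= hE -e.
Qed.

End DirectLimit.

(** * The quantum groups *)

(* S_n is 'S_n, the permutations of {0, ..., n-1}. The transposition of i and
   i+1 is the s_(i+1) of the 1-based numbering. *)
Definition nntransp n i (lt_i_n : (i.+1 < n)%N) : 'S_n :=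
  tperm (Ordinal (ltnW lt_i_n)) (Ordinal lt_i_n).

(* The automorphism s_i |-> s_(n-i), see theta_nntransp. *)
Definition rev_perm n : 'S_n := perm (@rev_ord_inj n).
Definition theta n (s : 'S_n) : 'S_n := (s ^ rev_perm n)%g.

Lemma theta_nntransp n i (lt_i : (i.+1 < n)%N) (lt_j : ((n - i.+2).+1 < n)%N) :
  theta (nntransp lt_i) = nntransp lt_j.
Proof.
rewrite /theta /nntransp tpermJ tpermC !permE.
congr tperm; apply: val_inj => //=.
by rewrite subnSK.
Qed.

Fact thetaM n : {morph @theta n : s t / (s * t)%g}.
Proof. by move=> s t; apply: conjMg. Qed.

Lemma thetaK n : involutive (@theta n).
Proof.
move=> s; rewrite /theta -conjgM (_ : _ * _ = 1)%g ?conjg1//.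
by apply/permP => i; rewrite permM perm1 !permE rev_ordK.
Qed.

(* The embedding s_i |-> s_(i+1), see phi_nntransp: s acts on the middle points
   {1, ..., n} of {0, ..., n+1}. *)
Definition phi n (s : 'S_n) : 'S_n.+2 :=
  lift_perm ord0 ord0 (lift_perm ord_max ord_max s).

Definition middle n (i : 'I_n) : 'I_n.+2 := lift ord0 (lift ord_max i).

Lemma middle_val n (i : 'I_n) : middle i = i.+1 :> nat.
Proof. by rewrite /= /bump leq0n leqNgt ltn_ord. Qed.

Lemma phi_middle n (s : 'S_n) i : phi s (middle i) = middle (s i).
Proof. by rewrite /phi /middle !lift_perm_lift. Qed.
Lemma phi_0 n (s : 'S_n) : phi s ord0 = ord0.
Proof. exact: lift_perm_id. Qed.
Lemma phi_max n (s : 'S_n) : phi s ord_max = ord_max.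
Proof.
have -> : ord_max = lift ord0 ord_max :> 'I_n.+2 by apply: val_inj.
by rewrite /phi lift_perm_lift lift_perm_id.
Qed.

Variant middle_spec n : 'I_n.+2 -> Prop :=
  | Middle_0 : middle_spec ord0
  | Middle_max : middle_spec ord_max
  | Middle_mid i : middle_spec (middle i).

Lemma middleP n (i : 'I_n.+2) : middle_spec i.
Proof.
case: (unliftP ord0 i) => [j ->|->]; last exact: Middle_0.
case: (unliftP ord_max j) => [k ->|->]; first exact: Middle_mid.
have -> : lift ord0 ord_max = ord_max :> 'I_n.+2 by apply: val_inj.
exact: Middle_max.
Qed.

Fact phiM n : {morph @phi n : s t / (s * t)%g}.
Proof. by move=> s t; rewrite /phi !lift_permM. Qed.

Lemma middle_inj n : injective (@middle n).
Proof. by move=> i j /lift_inj/lift_inj. Qed.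

Lemma phi_inj n : injective (@phi n).
Proof.
move=> s t e; apply/permP => i; apply: middle_inj.
by rewrite -!phi_middle e.
Qed.

Lemma phi_nntransp n i (lt_i : (i.+1 < n)%N) (lt_j : (i.+2 < n.+2)%N) :
  phi (nntransp lt_i) = nntransp lt_j.
Proof.
have e1 : Ordinal (ltnW lt_j) = middle (Ordinal (ltnW lt_i)).
  by apply: ord_inj; rewrite middle_val.
have e2 : Ordinal lt_j = middle (Ordinal lt_i).
  by apply: ord_inj; rewrite middle_val.
apply/permP => j; rewrite /nntransp e1 e2; case: (middleP j) => [||k].
- by rewrite phi_0 tpermD//; apply/eqP => /(congr1 (@nat_of_ord _)); rewrite middle_val.
- rewrite phi_max tpermD//; apply/eqP => /(congr1 (@nat_of_ord _)); rewrite middle_val /=.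
    by move=> [] e; have := ltnW lt_i; rewrite e ltnn.
  by move=> [] e; have := lt_i; rewrite e ltnn.
- by rewrite phi_middle -!(inj_tperm _ _ _ (@middle_inj n)).
Qed.

Lemma theta_phi n (s : 'S_n) : theta (phi s) = phi (theta s).
Proof.
have rm i : rev_perm n.+2 (middle i) = middle (rev_perm n i).
  apply: ord_inj; rewrite middle_val !permE.
  by rewrite -[LHS]/(n.+2 - (middle i).+1)%N middle_val subSS subSn.
have r0 : rev_perm n.+2 ord0 = ord_max.
  by apply: val_inj; rewrite permE /= subn1.
have rM : rev_perm n.+2 ord_max = ord0.
  by apply: val_inj; rewrite permE /= subnn.
apply/permP => i; rewrite -(permKV (rev_perm n.+2) i).
move: ((rev_perm n.+2)^-1%g i) => {}i.
rewrite /theta permJ; case: (middleP i) => [||k].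
- by rewrite phi_0 r0 phi_max.
- by rewrite phi_max rM phi_0.
- by rewrite phi_middle !rm phi_middle permJ.
Qed.

Section QuantumGroups.
Variable C : numClosedFieldType.

Definition theta_hom n : hopfStarHom (groupHopf C 'S_n) (groupHopf C 'S_n) :=
  groupHopf_hom C (@thetaM n).
Definition phi_hom n : hopfStarHom (groupHopf C 'S_n) (groupHopf C 'S_n.+2) :=
  groupHopf_hom C (@phiM n).

Lemma theta_homK n : involutive (theta_hom n).
Proof.
move=> a; rewrite /= gmap_comp -[RHS]gmap_id; congr gmap.
by apply/funext => s; apply: thetaK.
Qed.

Lemma phi_theta_hom n a : phi_hom n (theta_hom n a) = theta_hom n.+2 (phi_hom n a).
Proof.
rewrite /= !gmap_comp; congr gmap.
by apply/funext => s; rewrite /= theta_phi.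
Qed.

Definition PolG n : hopfStarAlgebra C := doubling (@theta_homK n).
Definition psi n : hopfStarHom (PolG n) (PolG n.+2) :=
  doubling_hom (@theta_homK n) (@theta_homK n.+2) (phi_hom n) (@phi_theta_hom n).

(* PolG k -> PolG (k + 2) -> PolG (k + 4) -> ..., along the maps psi *)
Definition PolG_system (k : nat) : hopfSystem C :=
  HopfSystem (fun m => psi (m.*2 + k)).

Definition PolG_even : hopfStarAlgebra C := dirlim (PolG_system 2).
Definition PolG_odd : hopfStarAlgebra C := dirlim (PolG_system 1).

End QuantumGroups.

(* Main.v *)
(* An isomorphism of the two limits preserves the unique nontrivial central
   grouplike element, the difference of the units of the two summands, hence
   each unit. On the first summand it is then given by an isomorphism of the
   groups S_infty, and the mixed components of the comultiplication force this
   isomorphism to intertwine the two reflections. But the reflections can be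
   told apart inside the abstract groups: the transpositions t are the elements
   of order 2 such that (t t^s)^6 = 1 for all s, and every transposition
   commutes with its image under a reflection without fixed point, whereas
   (0 1) does not commute with (0 -1). *)
From HB Require Import structures.
Require Import Defs.
From mathcomp Require Import all_boot all_order all_algebra.
From mathcomp Require Import reals complex.
From mathcomp Require Import all_fingroup.

Set Implicit Arguments.
Unset Strict Implicit.
Unset Printing Implicit Defensive.

Import GRing.Theory Num.Theory.
Local Open Scope ring_scope.

(** * Transpositions in finite symmetric groups and their behaviour under reversal *)

Section Transpositions.
Local Open Scope group_scope.

(** The order is 1 for equal pairs, 3 when the pairs share exactly one point (the case [key]), and
    divides 2 when they are disjoint or one of them is degenerate. *)
Lemma tperm_mul_expg6 (T : finType) (a b c d : T) :
  (tperm a b * tperm c d) ^+ 6 = 1.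
Proof.
have sq (x y : T) : tperm x y ^+ 2 = 1 by rewrite expgS expg1 tperm2.
have key (x y z : T) : x != y -> y != z -> x != z ->
    (tperm x y * tperm x z) ^+ 6 = 1.
  move=> xy yz xz.
  have e1 : tperm x z ^ tperm x y = tperm y z.
    by rewrite tpermJ tpermL tpermD.
  have e2 : tperm x y ^ tperm x z = tperm z y.
    by rewrite tpermJ tpermL tpermD// eq_sym.
  (* The braid relation: both sides equal [tperm y z], by the two conjugations above. *)
  have e3 : tperm x y * tperm x z * tperm x y = tperm x z * tperm x y * tperm x
    z.
    by move: e1 e2; rewrite /conjg !tpermV !mulgA [tperm z y]tpermC => -> ->.
  have e : (tperm x y * tperm x z) ^+ 3 = 1.
    rewrite !expgS expg0 mulg1 !mulgA e3 -!mulgA [in X in _ * X]mulgA.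
    by rewrite !mulgA -(mulgA _ (tperm x z) (tperm x z)) tperm2 mulg1
      -(mulgA _ (tperm x y) (tperm x y)) tperm2 mulg1 tperm2.
  by rewrite (expgM _ 3 2) e expg1n.
have [->|ab] := eqVneq a b; first by rewrite tperm1 mul1g (expgM _ 2 3) sq
  expg1n.
have [->|cd] := eqVneq c d; first by rewrite tperm1 mulg1 (expgM _ 2 3) sq
  expg1n.
have [ac|ac] := eqVneq a c.
  rewrite -{}ac in cd *; have [<-|bd] := eqVneq b d;
    first by rewrite tperm2 expg1n.
  exact: key.
have [ad|ad] := eqVneq a d.
  rewrite -{}ad (tpermC c) in cd *; have [<-|bd] := eqVneq b c;
    first by rewrite tperm2 expg1n.
  by apply: key; rewrite // eq_sym.
have [bc|bc] := eqVneq b c.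
  by rewrite -{}bc (tpermC a) in cd *; apply: key; rewrite // eq_sym.
have [bd|bd] := eqVneq b d.
  by rewrite -{}bd (tpermC a) (tpermC c) in cd *; apply: key; rewrite // eq_sym.
have cm : commute (tperm a b) (tperm c d).
  apply/commgP/conjg_fixP; rewrite tpermJ !tpermD // eq_sym //.
by rewrite expgMn // !(expgM _ 2 3) !sq !expg1n mulg1.
Qed.

Lemma tperm_noncommute (T : finType) (x y z : T) :
  x != y -> x != z -> y != z -> ~ commute (tperm x y) (tperm z y).
Proof.
move=> xy xz yz /permP/(_ x); rewrite !permM tpermL tpermR.
by rewrite (@tpermD _ z y) 1?eq_sym // tpermL; apply/eqP; rewrite eq_sym.
Qed.

(* If [t] also moves a point [b] outside [{a, t a}], then for the 3-cycle [s]
   on [a, b, o] the product [t * t ^ s] is a 5-cycle. *)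
Lemma tperm_of_expg6 (T : finType) (t : {perm T}) (o a : T) :
  t ^+ 2 = 1 -> t o = o -> t a != a ->
  (forall s, (t * t ^ s) ^+ 6 = 1) -> t = tperm a (t a).
Proof.
move=> t2 to ta ht; have tt x : t (t x) = x.
  by rewrite -permM -[t * t]/(t ^+ 2) t2 perm1.
apply/permP => b; case: tpermP => [->|->|/eqP ba /eqP bta]; rewrite ?tt //.
apply/eqP/negPn/negP => tb.
have ao : a != o by apply: contraNneq ta => ->; rewrite to.
have bo : b != o by apply: contraNneq tb => ->; rewrite to.
have tao : t a != o by apply: contraNneq ao => h; rewrite -[a]tt h to.
have tbo : t b != o by apply: contraNneq bo => h; rewrite -[b]tt h to.
have tba : t b != a by apply: contraNneq bta => <-; rewrite tt.
have tbta : t b != t a by rewrite (inj_eq perm_inj).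
pose s := tperm a b * tperm a o.
have sE := permM (tperm a b) (tperm a o).
have sa : s a = b by rewrite sE tpermL tpermD // eq_sym.
have sb : s b = o by rewrite sE tpermR tpermL.
have so : s o = a by rewrite sE (tpermD ao bo) tpermR.
have sta : s (t a) = t a by rewrite sE !tpermD // eq_sym.
have stb : s (t b) = t b by rewrite sE !tpermD // eq_sym.
have wE x : (t * t ^ s) (t (s x)) = s (t x) by rewrite permM tt permJ.
have w1 : (t * t ^ s) (t b) = t a by rewrite -{1}sa wE sta.
have w2 : (t * t ^ s) o = t b by rewrite -{1}to -{1}sb wE stb.
have w3 : (t * t ^ s) (t a) = a by rewrite -{1}so wE to so.
have w4 : (t * t ^ s) a = b by rewrite -{1}[a]tt -{1}sta wE tt sa.
have w5 : (t * t ^ s) b = o by rewrite -{1}[b]tt -{1}stb wE tt sb.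
have := ht s; move: (t * t ^ s) w1 w2 w3 w4 w5 => w w1 w2 w3 w4 w5.
(* Along the cycle [o], [t b], [t a], [a], [b] the sixth power acts as the first, so it sends [o] to
   [t b] and not to [o]. *)
move/permP => /(_ o); rewrite !expgS expg0 mulg1 !permM perm1.
by rewrite w2 w1 w3 w4 w5 w2 => /eqP; rewrite (negbTE tbo).
Qed.

Lemma theta_tperm n (a b : 'I_n) : theta (tperm a b) = tperm (rev_ord a)
  (rev_ord b).
Proof. by rewrite /theta tpermJ !permE. Qed.

Lemma phi_tperm n (a b : 'I_n) : phi (tperm a b) = tperm (middle a) (middle b).
Proof.
have mid_max (i : 'I_n) : middle i != ord_max.
  by rewrite -(inj_eq val_inj) [val (middle i)]middle_val /= eqSS ltn_eqF.
apply/permP => i; case: (middleP i) => [||j].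
- by rewrite phi_0 tpermD.
- by rewrite phi_max tpermD.
- by rewrite phi_middle -(inj_tperm _ _ _ (@middle_inj n)).
Qed.

(** On an even number of points the reversal has no fixed point, so it either exchanges [a] and [b]
    or sends the pair to a disjoint one. *)
Lemma theta_tperm_commute n (a b : 'I_n) : ~~ odd n ->
  commute (tperm a b) (theta (tperm a b)).
Proof.
move=> odd_n; have fixfree (i : 'I_n) : rev_ord i != i.
  apply: contra odd_n => /eqP/(congr1 val) /= e.
  by rewrite (_ : n = i + i.+1)%N ?oddD /= ?addbN ?addbb // -{1}e subnK.
rewrite theta_tperm; have [<-|ab] := eqVneq (rev_ord a) b.
  by rewrite rev_ordK tpermC.
apply/commgP/conjg_fixP; rewrite tpermJ !tpermD //.
by apply: contraNneq ab => <-; rewrite rev_ordK.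
Qed.

End Transpositions.

Lemma phi1 n : @phi n 1%g = 1%g.
Proof. by apply: (mulgI (phi 1%g)); rewrite -phiM !mulg1. Qed.

Lemma phiV n (s : 'S_n) : phi s^-1%g = (phi s)^-1%g.
Proof. by apply: (mulgI (phi s)); rewrite -phiM !mulgV phi1. Qed.

(** Finite-level form of the triviality of the centre of the infinite group. [phi s] fixes [ord0];
    commuting with the transposition of [ord0] and [middle i], it must fix [middle i] too. *)
Lemma phi_central n (s : 'S_n) : (forall r, phi s * r = r * phi s)%g -> s = 1%g.
Proof.
move=> h; apply/permP => i; apply: (@middle_inj n); rewrite perm1 -phi_middle.
by have /permP/(_ ord0) := h (tperm ord0 (middle i));
  rewrite !permM phi_0 tpermL.
Qed.

(** * Product functionals on tensor products *)

Section TensorCoefficients.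
Variables (C : numClosedFieldType) (V W : lmodType C).

Definition tcoef (f : V -> C^o) (g : W -> C^o) : V ⊗ W -> C^o :=
  tlift (fun x y => f x * g y : C^o).

Variables (f : V -> C^o) (g : W -> C^o).
Hypotheses (hf : linear f) (hg : linear g).

Let tcoef_bilin : bilin (fun x y => f x * g y : C^o).
Proof. exact: (bilin_comp (@bilin_mul C C^o) hf hg). Qed.

Lemma tcoefE x y : tcoef f g (x ⊗ y) = f x * g y.
Proof. exact: tlift_bilin. Qed.
Lemma tcoef_linear : linear (tcoef f g).
Proof. exact: bilin_tlift. Qed.

End TensorCoefficients.

(** * Basis and coordinates of the limit algebra; [k] is 2 in the even case and 1 in the odd one *)

Definition PolG_lim (C : numClosedFieldType) (k : nat) : hopfStarAlgebra C :=
  dirlim (PolG_system C k).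
Arguments PolG_lim : simpl never.

Local Notation gA C k m := (groupAlg C 'S_(m.*2 + k)).

(* Locking keeps unification from comparing elements of the inductive limit
   by unfolding them. *)
HB.lock Definition lim_pair (C : numClosedFieldType) (k m : nat)
    (d : doubleAlg (gA C k m)) : PolG_lim C k :=
  dirlim_in (PolG_system C k) m d.
HB.lock Definition limX (C : numClosedFieldType) (k m : nat)
    (s : 'S_(m.*2 + k)) : PolG_lim C k := lim_pair (dxi (gpt C s)).
HB.lock Definition limY (C : numClosedFieldType) (k m : nat)
    (s : 'S_(m.*2 + k)) : PolG_lim C k := lim_pair (deta (gpt C s)).
(* The Haar functional, up to normalisation. *)
HB.lock Definition tau (C : numClosedFieldType) (k : nat) : PolG_lim C k -> C^o
  :=
  @lim_lift C (PolG_system C k) C^o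
    (fun m (d : doubleAlg (gA C k m)) => d.1 1%g + d.2 1%g).
(* The coefficients of [limX s] and [limY s] in [x]. *)
HB.lock Definition xcoef (C : numClosedFieldType) (k m : nat)
    (s : 'S_(m.*2 + k)) (x : PolG_lim C k) : C^o := tau (limX C s^-1 * x).
HB.lock Definition ycoef (C : numClosedFieldType) (k m : nat)
    (s : 'S_(m.*2 + k)) (x : PolG_lim C k) : C^o := tau (limY C s^-1 * x).

Section Limit.
Variables (C : numClosedFieldType) (k : nat).
Local Notation A := (PolG_lim C k).
Local Notation "'S' m" := ('S_(m.*2 + k)) (at level 10, m at level 9).
Local Notation gA m := (groupAlg C (S m)).

Lemma lim_pair_linear m : linear (@lim_pair C k m).
Proof.
by rewrite lim_pair.unlock; apply: hom_linear (dirlim_in (PolG_system C k) m).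
Qed.

Lemma lim_pairM m (d e : doubleAlg (gA m)) :
  lim_pair d * lim_pair e = lim_pair (d * e).
Proof. by rewrite lim_pair.unlock -homM. Qed.

Lemma lim_pair1 m : @lim_pair C k m 1 = 1.
Proof. by rewrite lim_pair.unlock; apply: hom1. Qed.

Lemma lim_pairP (x : A) : exists m (d : doubleAlg (gA m)), x = lim_pair d.
Proof.
by have [m [d ->]] := @limP C (PolG_system C k) x; exists m, d;
  rewrite lim_pair.unlock.
Qed.

Lemma limX_phi m (s : S m) : @limX C k m.+1 (phi s) = limX C s.
Proof.
rewrite limX.unlock lim_pair.unlock
  -(dirlim_in_map (dxi (gpt C s) : PolG_system C k m)).
congr (hom_fun _ _); rewrite -[LHS]/(gpt C (phi s), 0)
  -[RHS]/(gmap _ _, gmap _ _).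
by rewrite gmap_gpt (linear_0 (@gmap_linear C _ _ _)).
Qed.
Lemma limXM m (s t : S m) : limX C s * limX C t = limX C (s * t)%g.
Proof. by rewrite limX.unlock lim_pairM dxiM gptM. Qed.
Lemma limXY m (s t : S m) : limX C s * limY C t = 0.
Proof.
by rewrite limX.unlock limY.unlock lim_pairM dxi_eta
  (linear_0 (@lim_pair_linear m)).
Qed.

Lemma lim_pair_comul m (d : doubleAlg (gA m)) :
  hcomul (lim_pair d) =
  tmap (@lim_pair C k m) (@lim_pair C k m) (dcomul (theta_hom C (m.*2 + k)) d).
Proof.
by rewrite lim_pair.unlock; apply:
  (hom_comul (dirlim_in (PolG_system C k) m) d).
Qed.

Lemma limX_comul m (s : S m) :
  hcomul (limX C s) = limX C s ⊗ limX C s + limY C s ⊗ limY C (theta s).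
Proof.
have hl := @lim_pair_linear m; have lt := hom_linear (theta_hom C (m.*2 + k)).
have lx := @dxi_linear C (gA m); have ly := @deta_linear C (gA m).
rewrite limX.unlock limY.unlock lim_pair_comul
  (dcomul_xi (theta_hom C _) (gpt C s)).
rewrite (_ : hcomul (gpt C s : groupHopf C (S m)) = gpt C s ⊗ gpt C s);
  last exact: gcomul_gpt.
rewrite (linear_add (tmap_linear hl hl)) !tmapE ?gmap_gpt //.
  by rewrite -(gmap_gpt C (@theta (m.*2 + k)) s).
all: exact: linear_comp.
Qed.

Lemma limY_comul m (s : S m) :
  hcomul (limY C s) = limX C s ⊗ limY C s + limY C s ⊗ limX C (theta s).
Proof.
have hl := @lim_pair_linear m; have lt := hom_linear (theta_hom C (m.*2 + k)).
have lx := @dxi_linear C (gA m); have ly := @deta_linear C (gA m).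
rewrite limX.unlock limY.unlock lim_pair_comul
  (dcomul_eta (theta_hom C _) (gpt C s)).
rewrite (_ : hcomul (gpt C s : groupHopf C (S m)) = gpt C s ⊗ gpt C s);
  last exact: gcomul_gpt.
rewrite (linear_add (tmap_linear hl hl)) !tmapE ?gmap_gpt //.
  by rewrite -(gmap_gpt C (@theta (m.*2 + k)) s).
all: exact: linear_comp.
Qed.

Lemma limX_counit m (s : S m) : hcounit (limX C s) = 1.
Proof.
by rewrite limX.unlock lim_pair.unlock
  (hom_counit (dirlim_in (PolG_system C k) m)); apply: gcounit_gpt.
Qed.

Lemma lim_pair_lext m (V : lmodType C) (f g : A -> V) : linear f -> linear g ->
  (forall s : S m, f (limX C s) = g (limX C s)) ->
  (forall s : S m, f (limY C s) = g (limY C s)) ->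
  forall d : doubleAlg (gA m), f (lim_pair d) = g (lim_pair d).
Proof.
move=> hf hg hX hY; have hl := @lim_pair_linear m.
apply: (double_lext (f := f \o @lim_pair C k m) (g := g \o @lim_pair C k m)).
- exact: linear_comp.
- exact: linear_comp.
- rewrite limX.unlock in hX; apply: gpt_lext hX;
    apply: linear_comp (@dxi_linear _ _); exact: linear_comp.
- rewrite limY.unlock in hY; apply: gpt_lext hY;
    apply: linear_comp (@deta_linear _ _); exact: linear_comp.
Qed.

(** As [phi] is injective, only the identity is sent to the identity; the coefficient there is thus
    preserved by the maps of the system, and the functional descends to the limit. *)
Lemma tau_pair m (d : doubleAlg (gA m)) : tau (lim_pair d) = d.1 1%g + d.2 1%g.
Proof.
have gmap1 n (a : groupHopf C (S n)) :
    (gmap (@phi (n.*2 + k)) a : groupAlg C _) 1%g = (a : gA n) 1%g.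
  rewrite /gmap sum_ffunE (bigD1 1%g) //= big1 ?addr0 => [|g g1].
    by rewrite !ffunE phi1 eqxx /GRing.scale /= mulr1.
  rewrite !ffunE [X in _ *: X](_ : _ = 0) ?scaler0 //.
  rewrite [_ == _](_ : _ = false) //; apply/negbTE; apply: contra g1 => /eqP e.
  by apply/eqP/(@phi_inj (n.*2 + k)); rewrite -e phi1.
rewrite tau.unlock lim_pair.unlock; apply: (@lim_liftE C (PolG_system C k) C^o
  (fun m (d : doubleAlg (gA m)) => d.1 1%g + d.2 1%g)) => n a.
by rewrite -[LHS]/((gmap _ _ : groupAlg C _) 1%g + (gmap _ _ : groupAlg C _) 1%g) !gmap1.
Qed.

Lemma tau_linear : linear (@tau C k).
Proof.
move=> c x y; have [n [a [b [-> ->]]]] := @lim2P C (PolG_system C k) x y.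
rewrite -lim_in_linear; have e := @tau_pair n; rewrite lim_pair.unlock in e;
  rewrite !e /= !ffunE /=.
by rewrite scalerDr [RHS]addrACA.
Qed.

Lemma xcoef_linear m (s : S m) : linear (@xcoef C k m s).
Proof.
by rewrite xcoef.unlock; apply: (linear_comp tau_linear (@linear_mull C A _)).
Qed.
Lemma ycoef_linear m (s : S m) : linear (@ycoef C k m s).
Proof.
by rewrite ycoef.unlock; apply: (linear_comp tau_linear (@linear_mull C A _)).
Qed.

Lemma gptM_at1 m (s : S m) (a : gA m) : (gpt C s^-1 * a : gA m) 1%g = a s.
Proof.
rewrite !ffunE (bigD1 s^-1%g) //= big1 ?addr0 => [|y /negbTE ys].
  by rewrite ffunE eqxx mul1r invgK mulg1.
by rewrite ffunE ys mul0r.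
Qed.

Lemma xcoef_pair m (s : S m) (d : doubleAlg (gA m)) : xcoef s (lim_pair d) =
  d.1 s.
Proof.
by rewrite xcoef.unlock limX.unlock lim_pairM tau_pair /= mul0r gptM_at1 ffunE
  addr0.
Qed.
Lemma ycoef_pair m (s : S m) (d : doubleAlg (gA m)) : ycoef s (lim_pair d) =
  d.2 s.
Proof.
by rewrite ycoef.unlock limY.unlock lim_pairM tau_pair /= mul0r gptM_at1 ffunE
  add0r.
Qed.

Lemma xxcoef m (s t : S m) : xcoef s (limX C t) = (s == t)%:R.
Proof. by rewrite limX.unlock xcoef_pair ffunE. Qed.
Lemma xycoef m (s t : S m) : xcoef s (limY C t) = 0.
Proof. by rewrite limY.unlock xcoef_pair ffunE. Qed.
Lemma yxcoef m (s t : S m) : ycoef s (limX C t) = 0.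
Proof. by rewrite limX.unlock ycoef_pair ffunE. Qed.
Lemma yycoef m (s t : S m) : ycoef s (limY C t) = (s == t)%:R.
Proof. by rewrite limY.unlock ycoef_pair ffunE. Qed.

(** The unit of the first summand does not depend on the level; its level 0 form serves as the
    normal form below. *)
Lemma limX1 m : limX C (1%g : S m) = limX C (1%g : S 0).
Proof.
by elim: m => // m <-; rewrite -(limX_phi (1%g : S m)) phi1.
Qed.

Lemma limX_inj m : injective (@limX C k m).
Proof.
move=> s t e; have := xxcoef s t; rewrite -e xxcoef eqxx.
by have [->//|_] := eqVneq s t; move/eqP; rewrite oner_eq0.
Qed.

(** * The comultiplication in coordinates, and grouplike elements *)

Lemma comul_xxcoef m (s t : S m) (d : doubleAlg (gA m)) :
  tcoef (xcoef s) (xcoef t) (hcomul (lim_pair d)) = (s == t)%:R * d.1 s.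
Proof.
have hs := xcoef_linear s; have ht := xcoef_linear t.
rewrite -xcoef_pair; move: d; apply: (lim_pair_lext
  (f := tcoef (xcoef s) (xcoef t) \o @hcomul C A)
  (g := fun x => (s == t)%:R * xcoef s x : C^o)).
- exact: (linear_comp (tcoef_linear hs ht) (@hcomul_linear _ A)).
- exact: (linear_comp (@linear_mull C C^o _) (xcoef_linear s)).
- move=> r; rewrite /comp limX_comul (linear_add (tcoef_linear hs ht)) !tcoefE
    //.
  rewrite !xxcoef !xycoef mul0r addr0.
  by have [->|sr] := eqVneq s r; rewrite ?eqxx ?mul1r ?mulr1 ?mul0r ?mulr0 //
    eq_sym.
- move=> r; rewrite /comp limY_comul (linear_add (tcoef_linear hs ht)) !tcoefE
    //.
  by rewrite !xxcoef !xycoef !(mul0r, mulr0) addr0.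
Qed.

Lemma comul_xycoef m (s t : S m) (d : doubleAlg (gA m)) :
  tcoef (xcoef s) (ycoef t) (hcomul (lim_pair d)) = (s == t)%:R * d.2 s.
Proof.
have hs := xcoef_linear s; have ht := ycoef_linear t.
rewrite -ycoef_pair; move: d; apply: (lim_pair_lext
  (f := tcoef (xcoef s) (ycoef t) \o @hcomul C A)
  (g := fun x => (s == t)%:R * ycoef s x : C^o)).
- exact: (linear_comp (tcoef_linear hs ht) (@hcomul_linear _ A)).
- exact: (linear_comp (@linear_mull C C^o _) (ycoef_linear s)).
- move=> r; rewrite /comp limX_comul (linear_add (tcoef_linear hs ht)) !tcoefE
    //.
  by rewrite !xycoef !yxcoef !(mul0r, mulr0) addr0.
- move=> r; rewrite /comp limY_comul (linear_add (tcoef_linear hs ht)) !tcoefE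
    //.
  rewrite !xxcoef !xycoef !yycoef mul0r addr0.
  by have [->|sr] := eqVneq s r; rewrite ?eqxx ?mul1r ?mulr1 ?mul0r ?mulr0 //
    eq_sym.
Qed.

(** Here the block is supported on the graph of [theta] instead of the diagonal: this is where the
    comultiplication records the reflection. *)
Lemma comul_yycoef m (s t : S m) (d : doubleAlg (gA m)) :
  tcoef (ycoef s) (ycoef t) (hcomul (lim_pair d)) = (t == theta s)%:R * d.1 s.
Proof.
have hs := ycoef_linear s; have ht := ycoef_linear t.
rewrite -xcoef_pair; move: d; apply: (lim_pair_lext
  (f := tcoef (ycoef s) (ycoef t) \o @hcomul C A)
  (g := fun x => (t == theta s)%:R * xcoef s x : C^o)).
- exact: (linear_comp (tcoef_linear hs ht) (@hcomul_linear _ A)).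
- exact: (linear_comp (@linear_mull C C^o _) (xcoef_linear s)).
- move=> r; rewrite /comp limX_comul (linear_add (tcoef_linear hs ht)) !tcoefE
    //.
  rewrite !xxcoef !yxcoef !yycoef mul0r add0r.
  by have [->|sr] := eqVneq s r; rewrite ?mul1r ?mulr1 ?mul0r ?mulr0.
- move=> r; rewrite /comp limY_comul (linear_add (tcoef_linear hs ht)) !tcoefE
    //.
  by rewrite !xycoef !yxcoef !(mul0r, mulr0) addr0.
Qed.

(** The first block of the comultiplication is the diagonal matrix with entries [d.1 s]. If it is
    also the rank one matrix with entries [d.1 s * d.1 t], at most one entry is nonzero, and it is
    1; the counit excludes zero. Only this block is constrained, so that the lemma also covers
    images of [limX], whose comultiplication has a further term in the second summand. *)
Lemma grouplike_fst (x : A) : hcounit x = 1 ->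
  (forall m (s t : S m),
     tcoef (xcoef s) (xcoef t) (hcomul x) = xcoef s x * xcoef t x) ->
  exists m (d : doubleAlg (gA m)) s, x = lim_pair d /\ d.1 = gpt C s.
Proof.
have [m [d ->]] := lim_pairP x => e1 hx; exists m, d.
have {}e1 : \sum_s d.1 s = 1.
  by rewrite -e1; symmetry; rewrite lim_pair.unlock;
    apply: (hom_counit (dirlim_in (PolG_system C k) m)).
have [s ds] : exists s, d.1 s != 0.
  apply/existsP; apply: contra_eqT e1; rewrite negb_exists => /forallP d0.
  by rewrite big1 1?eq_sym ?oner_eq0 // => s _; apply/eqP;
    rewrite -[_ == _]negbK.
have {}hx t : (s == t)%:R * d.1 s = d.1 s * d.1 t.
  by rewrite -comul_xxcoef hx !xcoef_pair.
exists s; split=> //; apply/ffunP => t; rewrite ffunE; apply: (mulfI ds).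
by rewrite -hx eq_sym mulrC.
Qed.

Lemma limX_fst m (d : doubleAlg (gA m)) (s : S m) :
  d.1 = gpt C s -> limX C (1%g : S m) * lim_pair d = limX C s.
Proof.
by move=> e; rewrite limX.unlock lim_pairM; congr lim_pair; congr pair;
  rewrite /= ?mul0r // e gptM mul1g.
Qed.

(** Centrality reduces the first component to the identity, the mixed block confines the second to a
    multiple of the identity, and the last block makes that scalar a square root of 1. It is -1
    since [u] is not 1, so [u] is the difference of the two units. *)
Lemma central_grouplike (u : A) : hcounit u = 1 -> hcomul u = u ⊗ u ->
  (forall x, u * x = x * u) -> u != 1 -> u + 1 = limX C (1%g : S 0) *+ 2.
Proof.
move=> e1 hu uC u1.
have htc (f g : A -> C^o) : linear f -> linear g ->
    tcoef f g (hcomul u) = f u * g u.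
  by move=> hf hg; rewrite hu tcoefE.
have [m [d [s [e d1]]]] : exists m (d : doubleAlg (gA m)) s,
    u = lim_pair d /\ d.1 = gpt C s.
  by apply: grouplike_fst => // m s t; rewrite htc //; apply: xcoef_linear.
have s1 : s = 1%g.
  apply: phi_central => r; apply: (@limX_inj m.+1).
  (* Cutting [u] down to the first summand one level up puts [s] in the form required by
     [phi_central]. *)
  have pu : limX C (1%g : S m.+1) * u = limX C (phi s : S m.+1).
    by rewrite limX1 -(limX1 m) e (limX_fst d1) limX_phi.
  rewrite -!limXM -pu -mulrA uC mulrA limXM mul1g.
  by rewrite -{1}[r]mulg1 -limXM -mulrA.
rewrite {}s1 in d1.
have d2 (t : S m) : t != 1%g -> d.2 t = 0.
  move=> t1; have := htc (xcoef (1%g : S m)) (ycoef t) (xcoef_linear _)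
    (ycoef_linear _).
  by rewrite e comul_xycoef xcoef_pair ycoef_pair d1 ffunE eqxx mul1r eq_sym
    (negbTE t1) mul0r.
have theta1 : theta (1%g : S m) = 1%g by apply: conj1g.
have c2 : d.2 1%g ^+ 2 = 1.
  have := htc (ycoef (1%g : S m)) (ycoef (1%g : S m)) (ycoef_linear _)
    (ycoef_linear _).
  by rewrite e comul_yycoef ycoef_pair theta1 eqxx d1 ffunE eqxx mul1r.
have d2E : d.2 = d.2 1%g *: gpt C 1%g.
  apply/ffunP => t; rewrite !ffunE; have [->|t1] := eqVneq t 1%g.
    by rewrite /GRing.scale /= mulr1.
  by rewrite (d2 t t1) /GRing.scale /= mulr0.
have {}c2 : d.2 1%g = -1.
  move/eqP: c2; rewrite sqrf_eq1 => /orP[|] /eqP // c1; case/eqP: u1.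
  rewrite e -(lim_pair1 m); congr lim_pair.
  by rewrite [d]surjective_pairing d2E d1 c1 scale1r.
have lD := linear_add (@lim_pair_linear m).
rewrite e -(lim_pair1 m) -lD mulr2n -(limX1 m) limX.unlock -lD; congr lim_pair.
by rewrite [d]surjective_pairing d2E d1 c2 scaleN1r; congr pair;
  rewrite /= ?addNr ?addr0.
Qed.

(** The exponent is positive because [limX C 1] is the unit of the first summand only, whereas a
    zeroth power is the unit of the whole algebra. *)
Lemma limX_expg m (s : S m) n :
  limX C s ^+ n.+1 = limX C (s ^+ n.+1)%g.
Proof. by elim: n => // n IH; rewrite exprS IH limXM -expgS. Qed.

Lemma limX_tperm m n (a b : 'I_(m.*2 + k)) :
  (m <= n)%N ->
  exists a' b' : 'I_(n.*2 + k), limX C (tperm a b) = limX C (tperm a' b').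
Proof.
move=> mn; rewrite -(subnK mn); elim: (n - m)%N => [|j [a' [b' ->]]].
  by exists a, b.
by exists (middle a'), (middle b'); rewrite -limX_phi phi_tperm.
Qed.

(** * The nontrivial central grouplike element *)

Lemma lim1XY : 1 = limX C (1%g : S 0) + limY C (1%g : S 0).
Proof.
by rewrite limX.unlock limY.unlock -(lim_pair1 0) double1
  (linear_add (@lim_pair_linear 0)).
Qed.

Lemma limX_central (x : A) : limX C (1%g : S 0) * x = x * limX C (1%g : S 0).
Proof.
have [m [d ->]] := lim_pairP x; rewrite -(limX1 m) limX.unlock !lim_pairM;
  congr lim_pair.
by congr pair; rewrite /= ?mul0r ?mulr0 ?mul1r ?mulr1.
Qed.

(** The difference of the units of the two summands, written so that centrality follows from that of
    [limX C 1]. *)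
Definition lim_sign : A := limX C (1%g : S 0) *+ 2 - 1.

Lemma lim_signE : lim_sign = limX C (1%g : S 0) - limY C (1%g : S 0).
Proof. by rewrite /lim_sign lim1XY mulr2n opprD addrA addrK. Qed.

Lemma lim_sign_central (x : A) : lim_sign * x = x * lim_sign.
Proof.
by rewrite /lim_sign mulrBl mulrBr mulrnAl mulrnAr limX_central mul1r mulr1.
Qed.

Lemma lim_sign_neq1 : lim_sign != 1.
Proof.
apply/eqP => /(congr1 (ycoef (1%g : S 0))).
rewrite lim_signE lim1XY !(linear_add (ycoef_linear _)).
rewrite -scaleN1r (linear_scale (ycoef_linear _)) yxcoef yycoef eqxx !add0r.
rewrite /GRing.scale /= mulr1 => /eqP.
by rewrite eq_sym -addr_eq0 (pnatr_eq0 C 2).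
Qed.

Lemma lim_sign_counit : hcounit lim_sign = 1.
Proof.
have h : linear (@hcounit _ A : A -> C^o) := @hcounit_scalar _ A.
rewrite /lim_sign mulr2n !(linear_add h) -scaleN1r (linear_scale h).
by rewrite hcounit1 limX_counit /GRing.scale /= mulr1 addrK.
Qed.

Lemma lim_sign_comul : hcomul lim_sign = lim_sign ⊗ lim_sign.
Proof.
have h := @hcomul_linear _ A; have theta1 : theta (1%g : S 0) = 1%g := conj1g _.
rewrite lim_signE -scaleN1r (linear_add h) (linear_scale h) limX_comul
  limY_comul.
rewrite theta1 !(tensDl, tensDr, tensZl, tensZr) !scalerDr !scalerA mulrNN
  mulr1 scale1r.
by rewrite -!addrA; congr (_ + _); rewrite addrC -!addrA; congr (_ + _);
  rewrite addrC.
Qed.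

End Limit.

(** * Action of an isomorphism on the first summand *)

Section LimitIso.
Variables (C : numClosedFieldType) (k k' : nat).
Variable f : hopfStarHom (PolG_lim C k) (PolG_lim C k').
Hypothesis f_bij : bijective f.
Local Notation "'S' m" := ('S_(m.*2 + k)) (at level 10, m at level 9).
Local Notation "'S'' m" := ('S_(m.*2 + k')) (at level 10, m at level 9).

Let f_linear : linear f := hom_linear f.

(** [f] sends [lim_sign] to a central grouplike element other than 1, hence to its counterpart;
    adding 1 and halving recovers the unit of the first summand. *)
Lemma hom_limX1 : f (limX C (1%g : S 0)) = limX C (1%g : S' 0).
Proof.
have [g gK fK] := f_bij.
have fu : f (lim_sign C k) + 1 = limX C (1%g : S' 0) *+ 2.
  apply: central_grouplike.
  - by rewrite hom_counit lim_sign_counit.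
  - by rewrite hom_comul lim_sign_comul tmapE.
  (* Surjectivity of [f] keeps a central element central. *)
  - by move=> x; rewrite -[x]fK -!homM lim_sign_central.
  - by rewrite -(hom1 f) (inj_eq (can_inj gK)) lim_sign_neq1.
move: fu; rewrite -(hom1 f) -(linear_add f_linear) subrK mulr2n.
rewrite (linear_add f_linear) -mulr2n -[in LHS]scaler_nat -[in RHS]scaler_nat.
by move/(scalerI _); apply; rewrite pnatr_eq0.
Qed.

(* [Delta (X s) = X s ⊗ X s + Y s ⊗ Y (theta s)] and [f (X s) = X r] give
   [f (Y s) ~ Y r]; then [Delta (Y s) = X s ⊗ Y s + Y s ⊗ X (theta s)] gives
   [f (X (theta s)) = X (theta r)]. *)
Lemma hom_limX m (s : S m) : exists n (r : S' n),
  [/\ f (limX C s) = limX C r, f (limX C s^-1%g) = limX C r^-1%g &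
      f (limX C (theta s)) = limX C (theta r)].
Proof.
have h1 n : f (limX C (1%g : S n)) = limX C (1%g : S' 0) by rewrite limX1
  hom_limX1.
(* As [f] respects the unit of the first summand, [f (limY C s)] lies in the second one. *)
have fY n (r : S' n) : limX C r * f (limY C s) = 0.
  rewrite -[r]mulg1 -limXM limX1 -mulrA -(h1 m) -homM limXY.
  by rewrite (linear_0 f_linear) mulr0.
have fX : hcomul (f (limX C s)) = f (limX C s) ⊗ f (limX C s)
    + f (limY C s) ⊗ f (limY C (theta s)).
  by rewrite hom_comul limX_comul (linear_add (tmap_linear _ _)) ?tmapE.
have [n [d [r [e d1]]]] : exists n (d : doubleAlg (groupAlg C (S' n))) r,
    f (limX C s) = lim_pair d /\ d.1 = gpt C r.
  apply: grouplike_fst => [|n r r']; first by rewrite hom_counit limX_counit.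
  have hr := @xcoef_linear C k' n r; have hr' := @xcoef_linear C k' n r'.
  have fYr : xcoef r (f (limY C s)) = 0.
    by rewrite xcoef.unlock fY (linear_0 (@tau_linear C k')).
  by rewrite fX (linear_add (tcoef_linear hr hr')) !tcoefE // fYr mul0r addr0.
have {d d1}e : f (limX C s) = limX C r.
  by rewrite -(limX_fst d1) -e limX1 -(h1 m) -homM limXM mul1g.
exists n, r; split=> //.
  (* Inverses are taken relative to [limX C 1], since [limX C s] is invertible only within the first
     summand. *)
  have := congr1 (fun x => limX C r^-1%g * x) (congr1 f (limXM C s s^-1%g)).
  rewrite mulgV h1 homM e mulrA limXM mulVg -(limX1 C k' n) limXM mulg1 => <-.
  by rewrite limX1 -(h1 m) -homM limXM mul1g.
have {}fX : f (limY C s) ⊗ f (limY C (theta s)) = limY C r ⊗ limY C (theta r).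
  by move: fX; rewrite e limX_comul => /addrI.
have [c ec] : exists c : C, c *: f (limY C s) = limY C r.
  (* The scalar comes from applying [ycoef (theta r)] to the second leg of [fX]. *)
  exists (ycoef (theta r) (f (limY C (theta s)))).
  have hb : bilin (fun (x y : PolG_lim C k') => (ycoef (theta r) y : C) *: x).
    split=> [y|x] b u v /=; first by rewrite scalerDr !scalerA mulrC.
    by rewrite (ycoef_linear (theta r)) scalerDl scalerA.
  have := congr1 (tlift (fun x y => (ycoef (theta r) y : C) *: x)) fX.
  by rewrite !tlift_bilin // yycoef eqxx scale1r.
have eY : limY C r ⊗ f (limX C (theta s)) = limY C r ⊗ limX C (theta r).
  apply: (addrI (limX C r ⊗ limY C r)); rewrite -limY_comul -[in RHS]ec.
  rewrite (linear_scale (@hcomul_linear _ _)) hom_comul limY_comul.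
  rewrite (linear_add (tmap_linear _ _)) ?tmapE // scalerDr.
  by rewrite -tensZr -tensZl ec e.
have hb : bilin (fun (x y : PolG_lim C k') => (ycoef r x : C) *: y).
  exact: (bilin_comp (@bilin_scale C (PolG_lim C k')) (ycoef_linear r) (@linear_id _ _)).
have := congr1 (tlift (fun x y => (ycoef r x : C) *: y)) eY.
by rewrite !tlift_bilin // yycoef eqxx !scale1r.
Qed.

End LimitIso.

(** * Comparison of the even and odd limits *)

Lemma hopfStarHom_inv (C : numClosedFieldType) (A B : hopfStarAlgebra C)
    (f : hopfStarHom A B) : bijective f ->
  exists g : hopfStarHom B A, cancel f g /\ cancel g f.
Proof.
case=> g fK gK; have f_inj := can_inj fK; have f_lin := hom_linear f.
have g_lin : linear g by move=> c x y; apply: f_inj; rewrite f_lin !gK.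
have gM x y : g (x * y) = g x * g y by apply: f_inj; rewrite homM !gK.
have g1 : g 1 = 1 by apply: f_inj; rewrite hom1 gK.
have g_star x : g (hstar x) = hstar (g x) by apply: f_inj; rewrite hom_star !gK.
have g_comul x : hcomul (g x) = tmap g g (hcomul x).
  rewrite -[x in RHS]gK hom_comul tmap_comp //.
  by rewrite (tmap_ext (f' := id) (g' := id)) ?tmap_id // => y; apply: fK.
by exists (HopfStarHom g_lin gM g1 g_star g_comul).
Qed.

Lemma PolG_even_odd_not_isomorphic (C : numClosedFieldType) :
  ~ hopf_isomorphic (PolG_even C) (PolG_odd C).
Proof.
case=> f0 f0_bij; have [g0 [fgK gfK]] := hopfStarHom_inv f0_bij.
pose f : hopfStarHom (PolG_lim C 2) (PolG_lim C 1) := f0.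
pose g : hopfStarHom (PolG_lim C 1) (PolG_lim C 2) := g0.
have fK : cancel f g := fgK; have gK : cancel g f := gfK.
have f_bij : bijective f by exists g.
have g_bij : bijective g by exists f.
(* Three points with centre [c], which the reversal fixes: [t] and its reflection share exactly the
   point [c], so they do not commute. *)
pose o : 'I_(1.*2 + 1) := @Ordinal 3 0 isT;
  pose c : 'I_(1.*2 + 1) := @Ordinal 3 1 isT.
pose t := tperm o c.
have [m [s [gt _ gtheta]]] := hom_limX g_bij t.
have s_theta : (s * theta s != theta s * s)%g.
  apply/eqP => /(congr1 (@limX C 2 m)).
  rewrite -(limXM C s (theta s)) -(limXM C (theta s) s) -gt -gtheta -!homM
    !limXM.
  move/(can_inj gK)/limX_inj.
  have -> : theta t = tperm (@Ordinal 3 2 isT) c.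
    by rewrite /t theta_tperm; congr tperm; apply: val_inj.
  exact: tperm_noncommute.
have s2 : (s ^+ 2 = 1)%g.
  apply: (@limX_inj C); rewrite expgS expg1 -limXM -gt -homM limXM tperm2.
  by rewrite (limX1 C 1) hom_limX1 // limX1.
(* The relation is taken one level up because [tperm_of_expg6] needs a fixed point, here [ord0], and
   conjugators that may move it. Under [f] it becomes a statement about two transpositions. *)
have s6 (r : 'S_(m.+1.*2 + 2)) : ((phi s * phi s ^ r) ^+ 6 = 1)%g.
  have [n [r' [fr frV _]]] := hom_limX f_bij r.
  have homX j x : f (x ^+ j) = f x ^+ j.
    by elim: j => [|j IH]; rewrite ?expr0 ?hom1 // !exprS homM IH.
  have fs : f (limX C (phi s : 'S_(m.+1.*2 + 2))) = limX C t.
    by rewrite limX_phi -gt gK.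
  (* [t] lives at level 1 and [r'] at level [n], possibly 0; both are moved to level [n.+1]. *)
  have [a [b tE]] := limX_tperm C o c (isT : 1 <= n.+1)%N.
  apply: (@limX_inj C 2 m.+1); apply: (can_inj fK).
  have r'E : limX C r' = limX C (phi r' : 'S_(n.+1.*2 + 1)) by rewrite limX_phi.
  have r'V : limX C r'^-1%g = limX C ((phi r')^-1%g : 'S_(n.+1.*2 + 1)).
    by rewrite -phiV limX_phi.
  rewrite -limX_expg homX /conjg -!limXM !homM fs fr frV.
  rewrite tE r'E r'V.
  rewrite !limXM limX_expg -[((phi r')^-1 * (_ * _))%g]/(tperm a b ^ phi r')%g.
  by rewrite tpermJ tperm_mul_expg6 (limX1 _ 2) hom_limX1 // limX1.
have [a sa] : exists a, s a != a.
  apply/existsP; apply: contraR s_theta; rewrite negb_exists => /forallP s_id.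
  have -> : s = 1%g by apply/permP => a; rewrite perm1; apply/eqP;
    rewrite -[_ == _]negbK.
  by rewrite mul1g mulg1.
have phi_s2 : (phi s ^+ 2 = 1)%g by rewrite expgS expg1 -phiM
  -[(s * s)%g]/(s ^+ 2)%g s2 phi1.
have phi_sa : phi s (middle a) != middle a by rewrite phi_middle
  (inj_eq (@middle_inj _)).
have n_even : ~~ odd (m.+1.*2 + 2) by rewrite oddD odd_double.
(* Since [phi] is injective and commutes with [theta], it suffices that [phi s], a transposition of
   an even number of points, commutes with its reflection. *)
case/eqP: s_theta; apply: (@phi_inj (m.*2 + 2));
  rewrite (phiM s (theta s)) (phiM (theta s) s) -theta_phi.
rewrite (tperm_of_expg6 phi_s2 (phi_0 s) phi_sa s6).
exact: (theta_tperm_commute _ _ n_even).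
Qed.

Theorem theorem5p3 (R : realType) :
  ~ hopf_isomorphic (PolG_even R[i]) (PolG_odd R[i]).
Proof. exact: PolG_even_odd_not_isomorphic. Qed.
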